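(* Let $g_1,\dots,g_m\in\mathbb{R}[x,y]$ ($m\ge1$) be nonzero, irreducible, pairwise distinct polynomials and let $Y=\{(x,y)\in\mathbb{R}^2: g_1(x,y)>0,\dots,g_m(x,y)>0\}$. Then there exists a cell decomposition $\mathcal{A}$ of $Y$ such that $(Y,\mathcal{A})$ is a CW complex and $\mathcal{A}$ has the finiteness property.
   Context: A cell decomposition of a set $X\subseteq\mathbb{R}^2$ is a partition of $X$ into (finitely or countably many) cells, each of which is a semi-algebraic set: 0-cells are points, 1-cells are subsets homeomorphic to an open interval, 2-cells are subsets homeomorphic to an open disk. A shortest-length curve in $X$ between two points $A,B\in X$ is a piecewise $C^2$ curve $\gamma$ from $A$ to $B$ lying entirely in $X$ whose length is minimal among all piecewise $C^2$ curves in $X$ from $A$ to $B$. A geodesic line segment (relative to the decomposition) is either a straight line segment or a connected arc contained (partially or entirely) in a 1-cell. A cell decomposition $\mathcal{A}$ of $X$ has the finiteness property if for every shortest-length curve $\gamma$ in $X$ between two points of $X$ and every cell $e\in\mathcal{A}$, the set $\gamma\cap e$ is either empty or has finitely many connected components, each of which is either a singleton or a geodesic line segment. *)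

(* Defs.v *)
From HB Require Import structures.
From mathcomp Require Import all_boot all_order all_algebra.
From mathcomp Require Import all_classical all_reals all_analysis.
Set Implicit Arguments. Unset Strict Implicit. Unset Printing Implicit Defensive.
Import Order.TTheory GRing.Theory Num.Theory.
Import numFieldNormedType.Exports.
Local Open Scope classical_set_scope.
Local Open Scope ring_scope.

(* outer variable = y, inner (coefficient) variable = x *)
Definition peval2 {R : realType} (p : {poly {poly R}}) (z : R * R) : R :=
  (p.[(z.2)%:P]).[z.1].

Definition irreducible2 {R : realType} (p : {poly {poly R}}) : Prop :=
  p \isn't a GRing.unit /\
  forall q r : {poly {poly R}}, p = q * r -> q \is a GRing.unit \/ r \is a GRing.unit.

Inductive semialg {R : realType} : set (R * R) -> Prop :=
  | sa_pos (p : {poly {poly R}}) : semialg [set z | 0 < peval2 p z]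
  | sa_compl (S : set (R * R)) : semialg S -> semialg (~` S)
  | sa_union (S T : set (R * R)) : semialg S -> semialg T -> semialg (S `|` T)
  | sa_inter (S T : set (R * R)) : semialg S -> semialg T -> semialg (S `&` T).

Definition homeomorphic {X Y : topologicalType} (A : set X) (B : set Y) : Prop :=
  exists (f : X -> Y) (g : Y -> X),
    (forall x, A x -> B (f x) /\ g (f x) = x) /\
    (forall y, B y -> A (g y) /\ f (g y) = y) /\
    {within A, continuous f} /\ {within B, continuous g}.

Definition open_unit_interval {R : realType} : set R := [set t | 0 < t < 1].
Definition open_unit_disk {R : realType} : set (R * R) :=
  [set z | z.1 ^+ 2 + z.2 ^+ 2 < 1].

Definition is_cell {R : realType} (e : set (R * R)) : Prop :=
  semialg e /\
  [\/ exists p : R * R, e = [set p],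
      homeomorphic e (@open_unit_interval R) |
      homeomorphic e (@open_unit_disk R)].

Definition cell_decomposition {R : realType} (X : set (R * R))
    (A : set (set (R * R))) : Prop :=
  [/\ countable A,
      (forall e, A e -> is_cell e /\ e !=set0),
      (forall e e', A e -> A e' -> e `&` e' !=set0 -> e = e') &
      X = \bigcup_(e in A) e].

(* standard closed n-balls D^n, their interiors and boundaries (n <= 2),
   all embedded in R^2:  D^0 = {0},  D^1 = [-1,1] x {0},  D^2 = closed unit disk *)
Definition ball_closed {R : realType} (n : nat) : set (R * R) :=
  match n with
  | 0 => [set (0, 0)]
  | 1 => [set z | -1 <= z.1 <= 1 /\ z.2 = 0]
  | _ => [set z | z.1 ^+ 2 + z.2 ^+ 2 <= 1]
  end.
Definition ball_interior {R : realType} (n : nat) : set (R * R) :=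
  match n with
  | 0 => [set (0, 0)]
  | 1 => [set z | -1 < z.1 < 1 /\ z.2 = 0]
  | _ => [set z | z.1 ^+ 2 + z.2 ^+ 2 < 1]
  end.
Definition ball_boundary {R : realType} (n : nat) : set (R * R) :=
  @ball_closed R n `\` @ball_interior R n.

Definition closed_in {R : realType} (Z S : set (R * R)) : Prop :=
  exists C : set (R * R), closed C /\ S `&` Z = C `&` Z.

Definition closure_in {R : realType} (X e : set (R * R)) : set (R * R) :=
  closure e `&` X.

(* (X, A) is a CW complex (X carries the subspace topology of R^2,
   hence is Hausdorff); cells have dimension <= 2. *)
Definition CW_complex {R : realType} (X : set (R * R))
    (A : set (set (R * R))) : Prop :=
  (forall e, A e -> e `<=` X /\ e !=set0) /\
  (forall e e', A e -> A e' -> e `&` e' !=set0 -> e = e') /\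
  X = \bigcup_(e in A) e /\
  exists dim : set (R * R) -> nat,
    (forall e, A e -> (dim e <= 2)%N /\
       exists Phi : R * R -> R * R,
         {within ball_closed (dim e), continuous Phi} /\
         Phi @` ball_closed (dim e) `<=` X /\
         Phi @` ball_interior (dim e) = e /\
         (exists Psi : R * R -> R * R,
            (forall u, ball_interior (dim e) u -> Psi (Phi u) = u) /\
            {within e, continuous Psi}) /\
         Phi @` ball_boundary (dim e) `<=`
           \bigcup_(e' in [set e' | A e' /\ (dim e' < dim e)%N]) e') /\
    (forall e, A e ->
       finite_set [set e' | A e' /\ closure_in X e `&` e' !=set0]) /\
    (forall S, S `<=` X ->
       (closed_in X S <->
        forall e, A e -> closed_in (closure_in X e) (S `&` closure_in X e))).

Definition unit_seg {R : realType} : set R := [set t | 0 <= t <= 1].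

Definition C2 {R : realType} (f : R -> R) : Prop :=
  (forall t, derivable f t 1) /\ (forall t, derivable (derive1 f) t 1) /\
  continuous (derive1n 2 f).

Definition pw_C2_curve {R : realType} (X : set (R * R)) (a b : R * R)
    (gam : R -> R * R) : Prop :=
  gam 0 = a /\ gam 1 = b /\
  (forall t, 0 <= t <= 1 -> X (gam t)) /\
  {within [set t : R | 0 <= t <= 1], continuous gam} /\
  exists (k : nat) (s : nat -> R),
    s 0%N = 0 /\ s k = 1 /\ (forall i, (i < k)%N -> s i < s i.+1) /\
    forall i, (i < k)%N ->
      exists h1 h2 : R -> R, C2 h1 /\ C2 h2 /\
        forall t, s i <= t <= s i.+1 -> gam t = (h1 t, h2 t).

(* Euclidean length  \int_0^1 |gam'(t)| dt  (gam' exists off finitely many t) *)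
Definition curve_length {R : realType} (gam : R -> R * R) : \bar R :=
  (\int[@lebesgue_measure R]_(t in @unit_seg R)
     (Num.sqrt ((derive1 (fun u => (gam u).1) t) ^+ 2 +
                (derive1 (fun u => (gam u).2) t) ^+ 2))%:E)%E.

Definition image01 {R : realType} (gam : R -> R * R) : set (R * R) :=
  gam @` [set t : R | 0 <= t <= 1].

Definition shortest_curve {R : realType} (X : set (R * R)) (gam : R -> R * R) : Prop :=
  exists a b, pw_C2_curve X a b gam /\
    forall del, pw_C2_curve X a b del -> (curve_length gam <= curve_length del)%E.

(* a (possibly open / half-open / closed) non-degenerate straight segment *)
Definition straight_segment {R : realType} (S : set (R * R)) : Prop :=
  exists p q : R * R, p <> q /\
    [set (p.1 + t * (q.1 - p.1), p.2 + t * (q.2 - p.2)) | t in [set t : R | 0 < t < 1]]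
      `<=` S /\
    S `<=` [set (p.1 + t * (q.1 - p.1), p.2 + t * (q.2 - p.2)) | t in [set t : R | 0 <= t <= 1]].

Definition is_arc {R : realType} (S : set (R * R)) : Prop :=
  exists I : set R, is_interval I /\ (exists u v, I u /\ I v /\ u <> v) /\ homeomorphic S I.

Definition geodesic_segment {R : realType} (A : set (set (R * R))) (S : set (R * R)) : Prop :=
  straight_segment S \/
  (connected S /\ is_arc S /\
   exists e, A e /\ homeomorphic e (@open_unit_interval R) /\ S `<=` e).

Definition components {R : realType} (S : set (R * R)) : set (set (R * R)) :=
  [set connected_component S x | x in S].

Definition finiteness_property {R : realType} (X : set (R * R))
    (A : set (set (R * R))) : Prop :=
  forall gam : R -> R * R, shortest_curve X gam ->
  forall e, A e ->
    finite_set (components (image01 gam `&` e)) /\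
    forall C, components (image01 gam `&` e) C ->
      (exists p, C = [set p]) \/ geodesic_segment A C.

Definition posset {R : realType} (m : nat) (g : 'I_m -> {poly {poly R}}) : set (R * R) :=
  [set z | forall i, 0 < peval2 (g i) z].

(* Main.v *)
Require Import Defs.
From HB Require Import structures.
From mathcomp Require Import all_boot all_order all_algebra.
From mathcomp Require Import all_classical all_reals all_analysis.
From mathcomp Require Import measurable_realfun.
From mathcomp Require Import ring lra zify.
Set Implicit Arguments. Unset Strict Implicit. Unset Printing Implicit Defensive.
Import Order.TTheory GRing.Theory Num.Theory.
Import numFieldNormedType.Exports.
Local Open Scope classical_set_scope.
Local Open Scope ring_scope.

(* Only the openness of the set matters: an open U in the plane has a Whitney
   decomposition into dyadic cells (open squares, open edges and vertices of the
   grids of mesh 2^-n), where the level of a point z is the least n such that a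
   neighbourhood of z of size about 2^-n lies in U.  Passing to a face of a cell can
   only increase the level, which gives the frontier condition; the levels near a
   closed cell exceed its own by at most 1, which gives closure finiteness, and local
   finiteness gives the weak topology.
   All these cells are convex.  Replacing the part of a shortest curve between two of
   its points in a convex cell by a chord shows, by the equality case of the triangle
   inequality, that the curve meets the cell in a convex subset of a line, hence in
   the empty set, a point or a straight segment. *)

(** * Piecewise C^2 curves and their length *)

(** The obstacle is that adjacent cells may have different levels: a side of a large square can be
    cut into smaller edges and vertices. Levels are therefore given to points, not to squares, and
    the cell of a point is read off the grid of its own level. The frontier of a cell then consists
    of cells at least as fine, each lying inside a proper face of the coarse grid and so of smaller
    dimension. The two bounds on the level (no decrease towards a face, increase by at most 1)
    dictate the shape of the tested neighbourhood, which must be wider around grid points than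
    inside grid intervals.

    For curves the basic inequality is that an arc is at least as long as its chord. Minimality
    compares extended reals, so the parts shared by a curve and its modification cancel only once
    all lengths are known to be finite. The parametrisation may stand still, so the trace is studied
    through its projection to a chord and the intermediate value theorem, not through tangents. *)

Definition eucl {R : realType} (p q : R * R) : R :=
  Num.sqrt ((q.1 - p.1) ^+ 2 + (q.2 - p.2) ^+ 2).

Definition speed {R : realType} (gam : R -> R * R) (t : R) : R :=
  Num.sqrt ((derive1 (fun u => (gam u).1) t) ^+ 2 +
            (derive1 (fun u => (gam u).2) t) ^+ 2).

(* The endpoints are left out because derive1 takes junk values at break points. *)
Definition open_length {R : realType} (gam : R -> R * R) (a b l : R) : Prop :=
  measurable_fun `]a, b[ (speed gam) /\
  (\int[@lebesgue_measure R]_(t in `]a, b[) (speed gam t)%:E = l%:E)%E.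

(** Each point of an open interval has a neighbourhood on which the two curves agree, so their
    derivatives agree there, whatever the curves do at the endpoints. This allows a curve to be
    exchanged for a smooth piece or for a chord. *)
Lemma open_length_eq {R : realType} (gam del : R -> R * R) (a b l : R) :
  (forall t, a < t < b -> gam t = del t) ->
  open_length gam a b l -> open_length del a b l.
Proof.
move=> gd; have sp t : t \in `]a, b[%classic -> (speed gam t)%:E = (speed del t)%:E.
  rewrite inE /= in_itv /= => tab.
  have nr : \forall u \near t, gam u = del u.
    have : \forall u \near t, u \in `]a, b[ by apply: near_in_itvoo; rewrite in_itv.
    by apply: filterS => u; rewrite in_itv /= => /gd.
  rewrite /speed !derive1E; congr (Num.sqrt (_ ^+ 2 + _ ^+ 2))%:E;
  by apply: near_eq_derive; apply: filterS nr => u ->.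
move=> [ms il]; split.
  by apply: eq_measurable_fun ms => t /sp [].
by rewrite -il; apply: eq_integral => t tab; rewrite sp.
Qed.

Lemma open_length_nil {R : realType} (gam : R -> R * R) (a : R) :
  open_length gam a a 0.
Proof.
rewrite /open_length set_itvoo0 //.
by split; [exact: measurable_fun_set0|rewrite integral_set0].
Qed.

Lemma open_length_cat {R : realType} (gam : R -> R * R) (a b c l l' : R) :
  a <= c <= b -> open_length gam a c l -> open_length gam c b l' ->
  open_length gam a b (l + l').
Proof.
move=> /andP[]; rewrite le_eqVlt => /predU1P[->|ac].
  move=> _ [_]; rewrite set_itvoo0 // integral_set0 => -[<-].
  by rewrite add0r.
rewrite le_eqVlt => /predU1P[->|cb].
  move=> + [_]; rewrite set_itvoo0 // integral_set0 => + -[<-].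
  by rewrite addr0.
move=> [m1 i1] [m2 i2].
have U : (`]a, b[%classic = (`]a, c[ `|` [set c]) `|` `]c, b[ :> set R).
  apply/seteqP; split=> t /=; rewrite !in_itv /=.
    move=> /andP[at_ tb]; case: (ltgtP t c) => [tc|tc|->]; last by left; right.
      by left; left; rewrite at_.
    by right.
  case=> [[/andP[-> /lt_trans]|->]|/andP[+ ->]]; rewrite ?ac //; first exact.
  by move=> /(lt_trans ac) ->.
have m3 : measurable_fun (`]a, c[ `|` [set c]) (speed gam).
  by apply/measurable_funU => //; split => //; exact: measurable_fun_set1.
have m4 : measurable_fun `]a, b[ (speed gam).
  rewrite U; apply/measurable_funU => //; exact: measurableU.
have IU (A B : set R) : measurable A -> measurable B ->
    measurable_fun (A `|` B) (speed gam) -> [disjoint A & B]%classic ->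
    (\int[@lebesgue_measure R]_(t in A `|` B) (speed gam t)%:E =
     \int[@lebesgue_measure R]_(t in A) (speed gam t)%:E +
     \int[@lebesgue_measure R]_(t in B) (speed gam t)%:E)%E.
  move=> mA mB mAB dAB; apply: ge0_integral_setU => //; first exact/measurable_EFinP.
  by move=> t _; rewrite lee_fin sqrtr_ge0.
split => //; rewrite U IU // -?U//.
- rewrite IU //; first by rewrite integral_set1 adde0 i1 i2 EFinD.
  by apply/disj_setPS => t [] /= + tc; rewrite tc in_itv/= ltxx andbF.
- exact: measurableU.
- apply/disj_setPS => t [] /= [|->]; rewrite !in_itv/= ?ltxx// => /andP[_ tc] /andP[/(lt_trans tc)].
  by rewrite ltxx.
Qed.

Lemma C2_continuous_derive1 {R : realType} (h : R -> R) : C2 h -> continuous (derive1 h).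
Proof.
by move=> [_ [dh _]] t; apply: differentiable_continuous; exact/derivable1_diffP.
Qed.

Lemma C2_continuous {R : realType} (h : R -> R) : C2 h -> continuous h.
Proof.
by move=> [dh _] t; apply: differentiable_continuous; exact/derivable1_diffP.
Qed.

Lemma eucl_ge0 {R : realType} (p q : R * R) : 0 <= eucl p q.
Proof. exact: sqrtr_ge0. Qed.

Lemma euclxx {R : realType} (p : R * R) : eucl p p = 0.
Proof. by rewrite /eucl !subrr expr0n /= addr0 sqrtr0. Qed.

Lemma dot_le_norm {R : realType} (a b c d : R) :
  a * c + b * d <= Num.sqrt (a ^+ 2 + b ^+ 2) * Num.sqrt (c ^+ 2 + d ^+ 2).
Proof.
rewrite -sqrtrM ?addr_ge0 ?sqr_ge0//; apply: (le_trans (ler_norm _)).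
rewrite -sqrtr_sqr ler_sqrt ?mulr_ge0 ?addr_ge0 ?sqr_ge0//.
rewrite -subr_ge0; have -> : (a ^+ 2 + b ^+ 2) * (c ^+ 2 + d ^+ 2) - (a * c + b * d) ^+ 2
  = (a * d - b * c) ^+ 2 by ring.
exact: sqr_ge0.
Qed.

Lemma eucl_triangle {R : realType} (p q r : R * R) : eucl p r <= eucl p q + eucl q r.
Proof.
rewrite -ler_sqr ?nnegrE ?addr_ge0 ?eucl_ge0//.
rewrite sqrrD !sqr_sqrtr ?addr_ge0 ?sqr_ge0//.
have := dot_le_norm (q.1 - p.1) (q.2 - p.2) (r.1 - q.1) (r.2 - q.2).
rewrite -/(eucl p q) -/(eucl q r); nra.
Qed.

Lemma continuous_sqrt_sqr2 {R : realType} {T : topologicalType} (f g : T -> R) (t : T) :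
  {for t, continuous f} -> {for t, continuous g} ->
  {for t, continuous (fun t => Num.sqrt (f t ^+ 2 + g t ^+ 2))}.
Proof.
move=> cf cg; apply: (@continuous_comp _ _ _ (fun t => f t ^+ 2 + g t ^+ 2)).
  apply: (@continuousD _ _ _ (fun t => f t ^+ 2) (fun t => g t ^+ 2));
  by [apply: (@continuousM _ _ f f)|apply: (@continuousM _ _ g g)].
exact: sqrt_continuous.
Qed.

(** Chord against arc: the inner product of the velocity with the chord vector integrates to D^2,
    and Cauchy-Schwarz bounds it pointwise by D times the speed. Finiteness comes from continuity of
    the speed on a compact interval. *)
Lemma C2_open_length {R : realType} (h1 h2 : R -> R) (a b : R) : a < b ->
  C2 h1 -> C2 h2 ->
  exists l, open_length (fun t => (h1 t, h2 t)) a b l /\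
    eucl (h1 a, h2 a) (h1 b, h2 b) <= l.
Proof.
move=> ab c1 c2; pose gam t := (h1 t, h2 t); pose D := eucl (h1 a, h2 a) (h1 b, h2 b).
have cs : continuous (speed gam).
  move=> t; apply: (@continuous_sqrt_sqr2 _ _ (derive1 h1) (derive1 h2) t).
    exact: (C2_continuous_derive1 c1).
  exact: (C2_continuous_derive1 c2).
have ispeed : lebesgue_measure.-integrable `[a, b] (EFin \o speed gam).
  apply: continuous_compact_integrable; first exact: segment_compact.
  exact: continuous_subspaceT.
have mspeed : measurable_fun `]a, b[ (speed gam).
  by apply: measurable_funTS; apply: continuous_measurable_fun.
have fl : (\int[@lebesgue_measure R]_(t in `[a, b]) (speed gam t)%:E)%E \is a fin_num.
  exact: integrable_fin_num ispeed.
exists (fine (\int[@lebesgue_measure R]_(t in `[a, b]) (speed gam t)%:E)); split.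
  split => //; rewrite -(integral_itv_bndoo true false); first by rewrite fineK.
  exact/measurable_EFinP.
set l := fine _.
have l0 : 0 <= l by apply/fine_ge0; apply: integral_ge0 => t _; rewrite lee_fin sqrtr_ge0.
pose dx := h1 b - h1 a; pose dy := h2 b - h2 a.
pose F t := dx * h1 t + dy * h2 t.
pose f t := dx * derive1 h1 t + dy * derive1 h2 t.
have dF (t : R) : is_derive t 1 F (f t).
  have [d1 _] := c1; have [d2 _] := c2.
  have i1 : is_derive t 1 h1 (derive1 h1 t) by rewrite derive1E; exact/derivableP.
  have i2 : is_derive t 1 h2 (derive1 h2 t) by rewrite derive1E; exact/derivableP.
  exact: (is_deriveD (is_deriveZ dx i1) (is_deriveZ dy i2)).
have cf : continuous f.
  move=> t; apply: (@continuousD _ _ _ (fun t => dx * derive1 h1 t) (fun t => dy * derive1 h2 t)).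
    apply: (@continuousM _ _ (cst dx) (derive1 h1)); first exact: cvg_cst.
    exact: (C2_continuous_derive1 c1).
  apply: (@continuousM _ _ (cst dy) (derive1 h2)); first exact: cvg_cst.
  exact: (C2_continuous_derive1 c2).
have cF : continuous F.
  move=> t; apply: differentiable_continuous; apply/derivable1_diffP.
  by have [] := dF t.
have FTC : (\int[lebesgue_measure]_(t in `[a, b]) (f t)%:E = (D ^+ 2)%:E)%E.
  rewrite (@continuous_FTC2 _ f F)//.
  - rewrite -EFinD; congr EFin; rewrite sqr_sqrtr ?addr_ge0 ?sqr_ge0//=.
    rewrite /F /dx /dy; ring.
  - exact: continuous_subspaceT.
  - split.
    + by move=> t _; have [] := dF t.
    + exact/cvg_at_right_filter/cF.
    + exact/cvg_at_left_filter/cF.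
  - move=> t _; rewrite derive1E; exact: derive_val.
have iF : lebesgue_measure.-integrable `[a, b] (EFin \o f).
  apply: continuous_compact_integrable; first exact: segment_compact.
  exact: continuous_subspaceT.
have : ((D ^+ 2)%:E <= (D * l)%:E)%E.
  rewrite -FTC EFinM fineK // -integralZl //.
  apply: le_integral => //; first exact: integrableZl.
  by move=> t _; rewrite -EFinM lee_fin /D /eucl /=; exact: dot_le_norm.
(* Dividing by D requires D > 0; for D = 0 the claim is [l0]. *)
rewrite lee_fin expr2; have := eucl_ge0 (h1 a, h2 a) (h1 b, h2 b); rewrite -/D.
rewrite le_eqVlt => /predU1P[<-//|D0]; by rewrite ler_pM2l.
Qed.

(** Concatenation replaces an indexed list of break points, so that restriction, continuity and
    additivity of length go by induction; indices occur only in the two conversions below. *)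
Inductive pwC2 {R : realType} (gam : R -> R * R) : R -> R -> Prop :=
| pwC2_piece a b h1 h2 : a < b -> C2 h1 -> C2 h2 ->
    (forall t, a <= t <= b -> gam t = (h1 t, h2 t)) -> pwC2 gam a b
| pwC2_cat a c b : pwC2 gam a c -> pwC2 gam c b -> pwC2 gam a b.

Lemma pwC2_lt {R : realType} (gam : R -> R * R) (a b : R) : pwC2 gam a b -> a < b.
Proof. by elim=> // {}a c {}b _ ac _ cb; exact: lt_trans cb. Qed.

Lemma pwC2_eq {R : realType} (gam del : R -> R * R) (a b : R) :
  (forall t, a <= t <= b -> gam t = del t) -> pwC2 gam a b -> pwC2 del a b.
Proof.
move=> + H; elim: H => {a b} [a b h1 h2 ab c1 c2 gh|a c b ac IH1 cb IH2] gd.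
  by apply: (pwC2_piece (h1 := h1) (h2 := h2)) => // t tab; rewrite -gd// gh.
have := pwC2_lt ac; have := pwC2_lt cb => lcb lac.
by apply: (pwC2_cat (c := c)); [apply: IH1|apply: IH2] => t tt; apply: gd; lra.
Qed.

Lemma pwC2_sub {R : realType} (gam : R -> R * R) (a b c d : R) :
  pwC2 gam a b -> a <= c -> c < d -> d <= b -> pwC2 gam c d.
Proof.
move=> H; elim: H c d => {a b} [a b h1 h2 ab c1 c2 gh|a e b ae IH1 eb IH2] c d ac cd db.
  by apply: (pwC2_piece (h1 := h1) (h2 := h2)) => // t tab; rewrite gh//; lra.
have [de|ed] := leP d e; first exact: IH1.
have [ec|ce] := leP e c; first exact: IH2.
by apply: (pwC2_cat (c := e)); [apply: IH1|apply: IH2] => //; lra.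
Qed.

Lemma continuous_pair {T U V : topologicalType} (f : T -> U) (g : T -> V) (t : T) :
  {for t, continuous f} -> {for t, continuous g} ->
  {for t, continuous (fun t => (f t, g t))}.
Proof. by move=> cf cg; exact: (cvg_pair cf cg). Qed.

Lemma pwC2_continuous {R : realType} (gam : R -> R * R) (a b : R) :
  pwC2 gam a b -> {within `[a, b], continuous gam}.
Proof.
elim=> {a b} [a b h1 h2 ab c1 c2 gh|a c b ac IH1 cb IH2].
  have cc : {within `[a, b], continuous (fun t => (h1 t, h2 t))}.
    by apply: continuous_subspaceT => t; apply: continuous_pair; exact: C2_continuous.
  apply: (subspace_eq_continuous _ cc) => t.
  by rewrite inE /= in_itv /= => /gh.
have := pwC2_lt ac; have := pwC2_lt cb => lcb lac.
have -> : `[a, b]%classic = `[a, c] `|` `[c, b] :> set R.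
  apply/seteqP; split => t /=; rewrite !in_itv /=; last by case; lra.
  by move=> tab; have [?|?] := leP t c; [left|right]; lra.
by apply: withinU_continuous => //; exact: interval_closed.
Qed.

Lemma pwC2_open_length {R : realType} (gam : R -> R * R) (a b : R) :
  pwC2 gam a b -> exists l, open_length gam a b l /\ eucl (gam a) (gam b) <= l.
Proof.
elim=> {a b} [a b h1 h2 ab c1 c2 gh|a c b ac [l [ol dl]] cb [l' [ol' dl']]].
  have [l [ol dl]] := C2_open_length ab c1 c2; exists l; split.
    by apply: open_length_eq ol => t tab; rewrite gh//; lra.
  by rewrite !gh//; lra.
exists (l + l'); have := pwC2_lt ac; have := pwC2_lt cb => lcb lac.
split; first by apply: open_length_cat ol ol'; lra.
by apply: (le_trans (eucl_triangle _ (gam c) _)); exact: lerD.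
Qed.

Lemma pwC2_of_breakpoints {R : realType} (gam : R -> R * R) (k : nat) (s : nat -> R) :
  (forall i, (i < k.+1)%N -> s i < s i.+1) ->
  (forall i, (i < k.+1)%N -> exists h1 h2 : R -> R, C2 h1 /\ C2 h2 /\
        forall t, s i <= t <= s i.+1 -> gam t = (h1 t, h2 t)) ->
  pwC2 gam (s 0%N) (s k.+1).
Proof.
elim: k => [|k IH] inc pc.
  have [h1 [h2 [c1 [c2 gh]]]] := pc 0%N isT.
  by apply: (pwC2_piece (h1 := h1) (h2 := h2)) => //; exact: inc.
apply: (pwC2_cat (c := s k.+1)).
  by apply: IH => i ik; [apply: inc|apply: pc]; exact: ltnW.
have [h1 [h2 [c1 [c2 gh]]]] := pc k.+1 (ltnSn _).
by apply: (pwC2_piece (h1 := h1) (h2 := h2)) => //; exact: inc.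
Qed.

Lemma breakpoints_of_pwC2 {R : realType} (gam : R -> R * R) (a b : R) :
  pwC2 gam a b ->
  exists (k : nat) (s : nat -> R),
    s 0%N = a /\ s k = b /\ (forall i, (i < k)%N -> s i < s i.+1) /\
    forall i, (i < k)%N ->
      exists h1 h2 : R -> R, C2 h1 /\ C2 h2 /\
        forall t, s i <= t <= s i.+1 -> gam t = (h1 t, h2 t).
Proof.
elim=> {a b} [a b h1 h2 ab c1 c2 gh|a c b ac].
  exists 1%N, (fun i => if i is 0%N then a else b); do 3!split => //; case=> // _.
  by exists h1, h2.
move=> [k [s [s0 [sk [si sp]]]]] cb [k' [s' [s'0 [s'k [s'i s'p]]]]].
exists (k + k')%N, (fun i => if (i <= k)%N then s i else s' (i - k)%N).
(* At the junction i = k both lists give c, so from k on the second one can be read. *)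
have E i : (k <= i)%N ->
    (if (i <= k)%N then s i else s' (i - k)%N) = s' (i - k)%N.
  rewrite leq_eqVlt => /predU1P[<-|]; first by rewrite leqnn subnn sk.
  by rewrite ltnNge => /negbTE ->.
split=> //; split; first by rewrite E ?leq_addr// addKn.
split=> i ikk; have [ik|ki] := ltnP i k.
- by rewrite ltnW //; exact: si.
- by rewrite !E ?leqW// subSn//; apply: s'i; rewrite ltn_subLR.
- by rewrite ltnW //; exact: sp.
- by rewrite !E ?leqW// subSn//; apply: s'p; rewrite ltn_subLR.
Qed.

(** Continuity is recovered from the pieces, which are closed and share their endpoints; k = 0 is
    excluded because 0 and 1 differ. *)
Lemma pw_C2_curveP {R : realType} (X : set (R * R)) (p q : R * R) (gam : R -> R * R) :
  pw_C2_curve X p q gam <->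
  [/\ gam 0 = p, gam 1 = q, forall t, 0 <= t <= 1 -> X (gam t) & pwC2 gam 0 1].
Proof.
split=> [[g0 [g1 [gX [_ [k [s [s0 [sk [si sp]]]]]]]]]|[g0 g1 gX pw]].
  split=> //; case: k sk si sp => [|k] sk si sp.
    by have := @ltr01 R; rewrite -s0 -sk ltxx.
  by rewrite -s0 -sk; exact: pwC2_of_breakpoints.
do 3!split => //; split; last exact: breakpoints_of_pwC2.
have -> : [set t : R | 0 <= t <= 1] = `[0, 1]%classic.
  by apply/seteqP; split => t /=; rewrite in_itv.
exact: pwC2_continuous pw.
Qed.

(** * Chords, and replacing part of a shortest curve by a chord *)

Definition seg {R : realType} (p q : R * R) (t : R) : R * R :=
  (p.1 + t * (q.1 - p.1), p.2 + t * (q.2 - p.2)).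

(** Equality case of the triangle inequality. Squaring gives |v||w| <= v.w for v = s - p and w = q -
    s; Lagrange's identity then makes the determinant of v and w vanish, and v.w >= 0 puts s between
    p and q. *)
Lemma eucl_between {R : realType} (p s q : R * R) :
  eucl p s + eucl s q <= eucl p q -> exists2 u, 0 <= u <= 1 & s = seg p q u.
Proof.
case: p s q => [p1 p2] [s1 s2] [q1 q2]; rewrite /eucl /seg /=.
set a := s1 - p1; set b := s2 - p2; set c := q1 - s1; set d := q2 - s2.
have -> : q1 - p1 = a + c by rewrite /a /c; ring.
have -> : q2 - p2 = b + d by rewrite /b /d; ring.
have -> : s1 = p1 + a by rewrite /a; ring.
have -> : s2 = p2 + b by rewrite /b; ring.
move: a b c d => a b c d {s1 s2 q1 q2}.
have x0 : 0 <= a ^+ 2 + b ^+ 2 by rewrite addr_ge0 ?sqr_ge0.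
have y0 : 0 <= c ^+ 2 + d ^+ 2 by rewrite addr_ge0 ?sqr_ge0.
have z0 : 0 <= (a + c) ^+ 2 + (b + d) ^+ 2 by rewrite addr_ge0 ?sqr_ge0.
have := sqr_sqrtr x0; have := sqr_sqrtr y0; have := sqr_sqrtr z0.
have := sqrtr_ge0 (a ^+ 2 + b ^+ 2); have := sqrtr_ge0 (c ^+ 2 + d ^+ 2).
have := sqrtr_ge0 ((a + c) ^+ 2 + (b + d) ^+ 2).
move: (Num.sqrt (a ^+ 2 + b ^+ 2)) (Num.sqrt (c ^+ 2 + d ^+ 2))
  (Num.sqrt ((a + c) ^+ 2 + (b + d) ^+ 2)) => X Y Z Z0 Y0 X0 EZ EY EX le.
have XY : X * Y <= a * c + b * d.
  have : (X + Y) ^+ 2 <= Z ^+ 2 by rewrite ler_sqr ?nnegrE // addr_ge0.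
  rewrite sqrrD EX EY EZ; lra.
have XY2 : (X * Y) ^+ 2 <= (a * c + b * d) ^+ 2.
  have XY0 : 0 <= X * Y by exact: mulr_ge0.
  by rewrite ler_sqr ?nnegrE // (le_trans XY0).
have cr : a * d - b * c = 0.
  apply/eqP; rewrite -sqrf_eq0 eq_le sqr_ge0 andbT.
  have -> : (a * d - b * c) ^+ 2 = (X * Y) ^+ 2 - (a * c + b * d) ^+ 2.
    rewrite exprMn EX EY; ring.
  by rewrite subr_le0.
have [Z00|Zn0] := eqVneq Z 0.
  have X00 : X = 0 by lra.
  have : a ^+ 2 + b ^+ 2 = 0 by rewrite -EX X00 expr0n.
  move/eqP; rewrite paddr_eq0 ?sqr_ge0 // !sqrf_eq0 => /andP[/eqP -> /eqP ->].
  by exists 0; rewrite ?lexx ?ler01 // !mul0r.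
have Zp : 0 < Z ^+ 2 by rewrite exprn_even_gt0.
have xy0 : 0 <= a * c + b * d by apply: le_trans XY; exact: mulr_ge0.
(* The parameter of the orthogonal projection of s to the line p q. *)
exists ((a * (a + c) + b * (b + d)) / Z ^+ 2).
  apply/andP; split.
    apply: divr_ge0; last exact: ltW.
    have -> : a * (a + c) + b * (b + d) = (a ^+ 2 + b ^+ 2) + (a * c + b * d) by ring.
    exact: addr_ge0.
  rewrite ler_pdivrMr // mul1r EZ -subr_ge0.
  have -> : (a + c) ^+ 2 + (b + d) ^+ 2 - (a * (a + c) + b * (b + d)) =
    (c ^+ 2 + d ^+ 2) + (a * c + b * d) by ring.
  exact: addr_ge0.
have Zn : Z ^+ 2 != 0 by rewrite lt0r_neq0.
congr (_ + _, _ + _).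
  rewrite mulrAC; apply: (canRL (mulfK Zn)); rewrite EZ.
  have -> : a * ((a + c) ^+ 2 + (b + d) ^+ 2) =
    (a * (a + c) + b * (b + d)) * (a + c) + (b + d) * (a * d - b * c) by ring.
  by rewrite cr mulr0 addr0; congr (_ * _); ring.
rewrite mulrAC; apply: (canRL (mulfK Zn)); rewrite EZ.
have -> : b * ((a + c) ^+ 2 + (b + d) ^+ 2) =
  (a * (a + c) + b * (b + d)) * (b + d) - (a + c) * (a * d - b * c) by ring.
by rewrite cr mulr0 subr0; congr (_ * _); ring.
Qed.

Lemma is_derive_affine {R : realType} (k c t : R) :
  is_derive t 1 (fun t : R => c + k * t) k.
Proof.
have E : 0 + k *: 1 = k by rewrite add0r /GRing.scale /= mulr1.
rewrite -[X in is_derive _ _ _ X]E.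
exact: (is_deriveD (is_derive_cst c t 1) (is_deriveZ k (is_derive_id t (1 : R)))).
Qed.

Lemma derive1_affine {R : realType} (k c : R) :
  derive1 (fun t : R => c + k * t) = cst k.
Proof.
apply/funext => t; rewrite derive1E.
by have /@derive_val := is_derive_affine k c t.
Qed.

Lemma C2_affine {R : realType} (k c : R) : C2 (fun t : R => c + k * t).
Proof.
split; first by move=> t; have [] := is_derive_affine k c t.
rewrite /derive1n /= derive1_affine.
split; first by move=> t; exact: derivable_cst.
have -> : (cst k : R -> R) = (fun t => k + 0 * t).
  by apply/funext => t; rewrite mul0r addr0.
by rewrite derive1_affine; exact: cst_continuous.
Qed.

Lemma seg_affine {R : realType} (p q : R * R) (a b t : R) : a < b ->
  seg p q ((t - a) / (b - a)) =
  (p.1 - a * (q.1 - p.1) / (b - a) + (q.1 - p.1) / (b - a) * t,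
   p.2 - a * (q.2 - p.2) / (b - a) + (q.2 - p.2) / (b - a) * t).
Proof.
by rewrite /seg -subr_gt0 => ab; congr pair; field; rewrite lt0r_neq0.
Qed.

Lemma seg_open_length {R : realType} (p q : R * R) (a b : R) : a < b ->
  open_length (fun t => seg p q ((t - a) / (b - a))) a b (eucl p q).
Proof.
move=> ab; have ba : 0 < b - a by rewrite subr_gt0.
have sp : speed (fun t => seg p q ((t - a) / (b - a))) = cst (eucl p q / (b - a)).
  apply/funext => t; rewrite /speed.
  under [X in derive1 X]eq_fun do rewrite seg_affine //=.
  rewrite derive1_affine.
  under [X in derive1 X]eq_fun do rewrite seg_affine //=.
  rewrite derive1_affine /eucl /= !exprMn -mulrDl sqrtrM ?addr_ge0 ?sqr_ge0 //.
  by rewrite sqrtr_sqr ger0_norm ?invr_ge0 // ltW.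
rewrite /open_length sp; split; first exact: measurable_cst.
transitivity (\int[@lebesgue_measure R]_(t in `]a, b[)
    cst (eucl p q / (b - a))%:E t)%E => //.
rewrite integral_cst; last exact: measurable_itv.
rewrite [X in (_ * X)%E](_ : _ = lebesgue_measure (`]a, b[%classic : set R)) //.
rewrite lebesgue_measure_itv /= lte_fin ab -EFinD -EFinM.
by rewrite divfK // lt0r_neq0.
Qed.

Lemma seg0 {R : realType} (p q : R * R) : seg p q 0 = p.
Proof. by case: p => p1 p2; rewrite /seg !mul0r !addr0. Qed.

Lemma seg1 {R : realType} (p q : R * R) : seg p q 1 = q.
Proof. by case: q => q1 q2; rewrite /seg !mul1r !subrKC. Qed.

Lemma seg_pwC2 {R : realType} (p q : R * R) (a b : R) : a < b ->
  pwC2 (fun t => seg p q ((t - a) / (b - a))) a b.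
Proof.
move=> ab; pose k (x y : R) := (y - x) / (b - a); pose c (x y : R) := x - a * (y - x) / (b - a).
apply: (@pwC2_piece _ _ _ _ (fun t => c p.1 q.1 + k p.1 q.1 * t)
  (fun t => c p.2 q.2 + k p.2 q.2 * t)) => //; [exact: C2_affine|exact: C2_affine|].
by move=> t _; exact: seg_affine.
Qed.

(** Unlike [pwC2], this admits a = b, which occurs when cut points coincide with each other or with
    0 or 1. *)
Lemma open_length_exists {R : realType} (gam : R -> R * R) (a b : R) :
  pwC2 gam 0 1 -> 0 <= a -> a <= b -> b <= 1 ->
  exists l, open_length gam a b l /\ eucl (gam a) (gam b) <= l.
Proof.
move=> pw a0; rewrite le_eqVlt => /predU1P[<- _|ab b1].
  by exists 0; rewrite euclxx; split => //; exact: open_length_nil.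
exact: pwC2_open_length (pwC2_sub pw a0 ab b1).
Qed.

Lemma curve_length_open {R : realType} (gam : R -> R * R) (l : R) :
  open_length gam 0 1 l -> curve_length gam = l%:E.
Proof.
move=> [ms il]; rewrite /curve_length -il.
have -> : @unit_seg R = `[0, 1]%classic.
  by apply/seteqP; split => t /=; rewrite /unit_seg /= in_itv.
by rewrite (integral_itv_bndoo true false) //; exact/measurable_EFinP.
Qed.

Definition splice {R : realType} (gam : R -> R * R) (a b : R) (t : R) : R * R :=
  if a <= t <= b then seg (gam a) (gam b) ((t - a) / (b - a)) else gam t.

(** The cut points are included, since chord and curve agree there; the outer pieces of the spliced
    curve are thus closed, as [pwC2] asks. *)
Lemma splice_out {R : realType} (gam : R -> R * R) (a b t : R) : a < b ->
  t <= a \/ b <= t -> splice gam a b t = gam t.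
Proof.
move=> ab h; rewrite /splice; case: ifPn => // /andP[at_ tb].
have [->|->] : t = a \/ t = b by case: h => ?; [left|right]; lra.
  by rewrite subrr mul0r seg0.
by rewrite divff ?seg1 // subr_eq0 gt_eqF.
Qed.

Lemma splice_in {R : realType} (gam : R -> R * R) (a b t : R) :
  a <= t <= b -> splice gam a b t = seg (gam a) (gam b) ((t - a) / (b - a)).
Proof. by rewrite /splice => ->. Qed.

Lemma splice_pwC2 {R : realType} (gam : R -> R * R) (a b : R) :
  pwC2 gam 0 1 -> 0 <= a -> a < b -> b <= 1 -> pwC2 (splice gam a b) 0 1.
Proof.
move=> pw a0 ab b1.
have pab : pwC2 (splice gam a b) a b.
  apply: pwC2_eq (seg_pwC2 (gam a) (gam b) ab) => t tab.
  by rewrite splice_in.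
have p0b : pwC2 (splice gam a b) 0 b.
  move: (a0); rewrite le_eqVlt => /predU1P[->//|a0'].
  apply: pwC2_cat pab; apply: pwC2_eq (pwC2_sub pw (lexx 0) a0' _); last lra.
  by move=> t ta; rewrite splice_out //; left; lra.
move: (b1); rewrite le_eqVlt => /predU1P[<-//|b1'].
apply: pwC2_cat p0b _; apply: pwC2_eq (pwC2_sub pw _ b1' (lexx 1)); last lra.
by move=> t ta; rewrite splice_out //; right; lra.
Qed.

(** The cuts at a, s, b give finite lengths l0, l1, l2, l3. Comparison with the spliced curve
    cancels l0 and l3 and leaves l1 + l2 at most the chord, while l1 and l2 dominate the two chords
    meeting at [gam s]: equality holds in the triangle inequality. *)
Lemma shortest_curve_between {R : realType} (X : set (R * R)) (gam : R -> R * R) (a s b : R) :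
  shortest_curve X gam -> 0 <= a -> a < b -> b <= 1 -> a <= s <= b ->
  (forall u, 0 <= u <= 1 -> X (seg (gam a) (gam b) u)) ->
  exists2 u, 0 <= u <= 1 & gam s = seg (gam a) (gam b) u.
Proof.
move=> [p [q [/pw_C2_curveP[g0 g1 gX pw] short]]] a0 ab b1 /andP[as_ sb] segX.
have [l0 [ol0 _]] := open_length_exists pw (lexx 0) a0 (ltac:(lra) : a <= 1).
have [l1 [ol1 d1]] := open_length_exists pw a0 as_ (ltac:(lra) : s <= 1).
have [l2 [ol2 d2]] := open_length_exists pw (ltac:(lra) : 0 <= s) sb b1.
have [l3 [ol3 _]] := open_length_exists pw (ltac:(lra) : 0 <= b) b1 (lexx 1).
have og : open_length gam 0 1 (l0 + ((l1 + l2) + l3)).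
  apply: open_length_cat ol0 _; first lra.
  apply: open_length_cat ol3; first lra.
  by apply: open_length_cat ol1 ol2; lra.
have os : open_length (splice gam a b) 0 1 (l0 + (eucl (gam a) (gam b) + l3)).
  apply: (open_length_cat (c := a)); first lra.
    by apply: open_length_eq ol0 => t ta; rewrite splice_out //; left; lra.
  apply: (open_length_cat (c := b)); first lra.
    apply: open_length_eq (seg_open_length (gam a) (gam b) ab) => t tab.
    by rewrite splice_in //; lra.
  by apply: open_length_eq ol3 => t ta; rewrite splice_out //; right; lra.
have pws : pw_C2_curve X p q (splice gam a b).
  apply/pw_C2_curveP; split; last exact: splice_pwC2.
  - by rewrite splice_out //; left.
  - by rewrite splice_out //; right.
  move=> t t01; rewrite /splice; case: ifPn => [/andP[at_ tb]|_]; last exact: gX.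
  apply: segX; rewrite divr_ge0 ?subr_ge0 //=; last exact: ltW.
  by rewrite ler_pdivrMr ?subr_gt0 // mul1r; lra.
have := short _ pws; rewrite (curve_length_open og) (curve_length_open os) lee_fin => le.
by apply: eucl_between; lra.
Qed.

(** * Shortest curves in convex cells *)

Definition convex2 {R : realType} (S : set (R * R)) : Prop :=
  forall p q u, S p -> S q -> 0 <= u <= 1 -> S (seg p q u).

Lemma segxx {R : realType} (p : R * R) (u : R) : seg p p u = p.
Proof. by case: p => p1 p2; rewrite /seg !subrr mulr0 !addr0. Qed.

Lemma segC {R : realType} (p q : R * R) (u : R) : seg q p (1 - u) = seg p q u.
Proof. by rewrite /seg; congr pair; ring. Qed.

Lemma seg_continuous {R : realType} (p q : R * R) : continuous (seg p q).
Proof.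
have c (x k : R) : continuous (fun u : R => x + u * k).
  rewrite (_ : (fun u => _) = (fun u => x + k * u)); last by apply/funext => u; rewrite mulrC.
  exact: C2_continuous (C2_affine k x).
by move=> t; exact: (continuous_pair (c _ _ t) (c _ _ t)).
Qed.

(** Between two parameters with values in e the curve stays on their chord, which lies in X by
    convexity. By the intermediate value theorem its projection to the chord direction misses no
    value, so the whole chord is traced. *)
Lemma shortest_curve_convex {R : realType} (X e : set (R * R)) (gam : R -> R * R) :
  shortest_curve X gam -> convex2 e -> e `<=` X -> convex2 (image01 gam `&` e).
Proof.
move=> sh ce eX.
suff H s t u : 0 <= s <= t -> t <= 1 -> e (gam s) -> e (gam t) -> 0 <= u <= 1 ->
    image01 gam (seg (gam s) (gam t) u).
  move=> p q u [[s /andP[s0 s1] <-] es] [[t /andP[t0 t1] <-] et] u01.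
  split; last exact: ce.
  have [st|ts] := leP s t; first by apply: H => //; rewrite s0.
  by rewrite -segC; apply: H => //; lra.
move=> /andP[s0]; rewrite le_eqVlt => /predU1P[<- t1 es et u01|st t1 es et u01].
  by exists s; rewrite ?segxx //= s0.
have [pq|pq] := pselect (gam s = gam t).
  by rewrite -pq segxx; exists s; rewrite //= s0 (le_trans (ltW st)).
pose d1 := (gam t).1 - (gam s).1; pose d2 := (gam t).2 - (gam s).2.
(* At the chord point of parameter v this takes the value v * (d1^2 + d2^2), so f determines v. *)
pose f r := ((gam r).1 - (gam s).1) * d1 + ((gam r).2 - (gam s).2) * d2.
have N0 : 0 < d1 ^+ 2 + d2 ^+ 2.
  rewrite lt_neqAle addr_ge0 ?sqr_ge0 // andbT eq_sym paddr_eq0 ?sqr_ge0 //.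
  apply/negP; rewrite !sqrf_eq0 !subr_eq0 => /andP[/eqP e1 /eqP e2]; apply: pq.
  by rewrite [gam s]surjective_pairing [gam t]surjective_pairing e1 e2.
have [p [q [/pw_C2_curveP[_ _ _ pw] _]]] := sh.
have cg := pwC2_continuous (pwC2_sub pw s0 st t1).
have cf : {within `[s, t], continuous f}.
  pose F (z : R * R) := (z.1 - (gam s).1) * d1 + (z.2 - (gam s).2) * d2.
  have cF : continuous F.
    move=> z; apply: (@continuousD _ _ _ (fun z : R * R => (z.1 - (gam s).1) * d1)
      (fun z : R * R => (z.2 - (gam s).2) * d2)).
      apply: (@continuousM _ _ (fun z : R * R => (z.1 - (gam s).1)) (cst d1)); last exact: cvg_cst.
      by apply: (@continuousB _ _ _ fst (cst _)); [exact: cvg_fst|exact: cvg_cst].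
    apply: (@continuousM _ _ (fun z : R * R => (z.2 - (gam s).2)) (cst d2)); last exact: cvg_cst.
    by apply: (@continuousB _ _ _ snd (cst _)); [exact: cvg_snd|exact: cvg_cst].
  move=> r; apply: (@continuous_comp _ _ _ (from_subspace `[s, t]%classic gam) F).
    exact: cg.
  exact: cF.
have fs : f s = 0 by rewrite /f !subrr !mul0r addr0.
have ft : f t = d1 ^+ 2 + d2 ^+ 2 by rewrite /f -/d1 -/d2 -!expr2.
have [r] : exists2 r, r \in `[s, t] & f r = u * (d1 ^+ 2 + d2 ^+ 2).
  apply: IVT => //; first exact: ltW.
  move: u01 => /andP[u0 u1]; rewrite fs ft min_l ?max_r ?(ltW N0) //.
  by rewrite mulr_ge0 ?(ltW N0) //= ler_piMl // ltW.
rewrite in_itv /= => srt fr.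
have [v v01 gr] : exists2 v, 0 <= v <= 1 & gam r = seg (gam s) (gam t) v.
  apply: (shortest_curve_between sh) => // w w01; apply: eX; exact: ce.
have uv : u = v.
  apply: (mulIf (lt0r_neq0 N0)); rewrite -fr /f gr /seg /= -/d1 -/d2; ring.
exists r; last by rewrite gr uv.
by move: srt => /andP[sr rt]; apply/andP; split; lra.
Qed.

(** Of three parameters, the middle one is sent to the chord of the outer two. Since p, q, r may
    come in any order in time, the argument goes through a determinant condition [col], stable under
    the permutations generated by [swap] and [cyc], and converts it to a parameter along p q only at
    the end. *)
Lemma shortest_curve_collinear {R : realType} (X e : set (R * R)) (gam : R -> R * R) (p q r : R * R) :
  shortest_curve X gam -> convex2 e -> e `<=` X ->
  (image01 gam `&` e) p -> (image01 gam `&` e) q -> (image01 gam `&` e) r -> p <> q ->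
  exists v, r = seg p q v.
Proof.
move=> sh ce eX.
pose col (a b c : R * R) := (b.1 - a.1) * (c.2 - a.2) = (b.2 - a.2) * (c.1 - a.1).
have swap x y z : col x y z -> col x z y.
  by rewrite /col => E; rewrite [LHS]mulrC -E mulrC.
have cyc x y z : col x y z -> col y z x.
  rewrite /col => E; apply/eqP; rewrite -subr_eq0.
  suff -> : (z.1 - y.1) * (x.2 - y.2) - (z.2 - y.2) * (x.1 - y.1) =
    (y.1 - x.1) * (z.2 - x.2) - (y.2 - x.2) * (z.1 - x.1) by rewrite E subrr.
  ring.
have H a b c : 0 <= a <= b -> b <= c <= 1 -> e (gam a) -> e (gam c) ->
    col (gam a) (gam b) (gam c).
  move=> /andP[a0 ab] /andP[bc c1] ea ec.
  have [ac|ca] := ltP a c; last first.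
    have -> : b = a by lra.
    by rewrite /col !subrr !mul0r.
  have [||u _ ->] := @shortest_curve_between _ _ _ a b c sh a0 ac c1.
  - by rewrite ab.
  - by move=> u u01; apply: eX; exact: ce.
  rewrite /col /seg /=; ring.
move=> [[a /andP[a0 a1] <-] ea] [[b /andP[b0 b1] <-] eb] [[c /andP[c0 c1] <-] ec] pq.
have {H} : col (gam a) (gam b) (gam c).
  have [ab|/ltW ba] := leP a b; have [bc|/ltW cb] := leP b c; have [ac|/ltW ca] := leP a c.
  - by apply: H; rewrite ?a0 ?bc.
  - by apply: H; rewrite ?a0 ?bc.
  - by apply/swap/H => //; lra.
  - by apply/cyc/H => //; lra.
  - by apply/cyc/cyc/swap/H => //; lra.
  - by apply/cyc/cyc/H => //; lra.
  - by apply/cyc/swap/H => //; lra.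
  - by apply/cyc/swap/H => //; lra.
move: (gam a) (gam b) (gam c) pq => [p1 p2] [q1 q2] [r1 r2] pq; rewrite /col /seg /= => C.
have [e1|n1] := eqVneq q1 p1.
  have [e2|n2] := eqVneq q2 p2; first by case: pq; rewrite e1 e2.
  have n2' : q2 - p2 != 0 by rewrite subr_eq0.
  exists ((r2 - p2) / (q2 - p2)); rewrite divfK // subrKC; congr pair.
  move: C; rewrite e1 subrr mul0r mulr0 addr0 => /esym/eqP.
  by rewrite mulf_eq0 (negbTE n2') /= subr_eq0 => /eqP.
have n1' : q1 - p1 != 0 by rewrite subr_eq0.
exists ((r1 - p1) / (q1 - p1)); rewrite divfK // subrKC; congr pair.
rewrite mulrAC [_ * (q2 - p2)]mulrC -C; field.
exact: n1'.
Qed.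

(** The parameters of S along p q form an interval L containing 0 and 1. It is bounded, as seen in a
    coordinate where p and q differ, so its interior is the open interval from [inf L] to [sup L];
    these parameters give the ends of the segment, whether or not L contains them. *)
Lemma convex_in_line {R : realType} (S : set (R * R)) (p q : R * R) (M : R) :
  convex2 S -> S p -> S q -> p <> q ->
  (forall r, S r -> exists v, r = seg p q v) ->
  (forall r, S r -> `|r.1| <= M /\ `|r.2| <= M) ->
  connected S /\ straight_segment S.
Proof.
move=> cS Sp Sq pq line bd.
pose L : set R := [set v | S (seg p q v)].
have L0 : L 0 by rewrite /L /= seg0.
have L1 : L 1 by rewrite /L /= seg1.
have SL : S = seg p q @` L.
  apply/seteqP; split => [r Sr|_ [v Lv <-] //].
  by have [v rv] := line r Sr; exists v => //; rewrite /L /= -rv.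
have iL : is_interval L.
  move=> x y Lx Ly z /andP[xz zy].
  have [xy|yx] := ltP x y; last by have -> : z = x by lra.
  have yx0 : y - x != 0 by rewrite subr_eq0 gt_eqF.
  have := cS _ _ ((z - x) / (y - x)) Lx Ly.
  rewrite /L /=; suff -> : seg (seg p q x) (seg p q y) ((z - x) / (y - x)) = seg p q z.
    apply; rewrite divr_ge0 ?subr_ge0 ?(ltW xy) //= ler_pdivrMr ?subr_gt0 //.
    by rewrite mul1r lerB.
  by rewrite /seg /=; congr pair; field.
have [B LB] : exists B, forall v, L v -> `|v| <= B.
  have bnd x y : (y - x != 0) -> (forall v, L v -> `|x + v * (y - x)| <= M) ->
      exists B, forall v, L v -> `|v| <= B.
    move=> d0 bM; exists ((M + `|x|) / `|y - x|) => v /bM {}bM.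
    rewrite ler_pdivlMr ?normr_gt0 // -normrM.
    have -> : v * (y - x) = (x + v * (y - x)) - x by ring.
    by apply: (le_trans (ler_normB _ _)); rewrite lerD2r.
  have [e1|n1] := eqVneq (q.1 - p.1) 0.
    have [e2|n2] := eqVneq (q.2 - p.2) 0; last first.
      by apply: (bnd _ _ n2) => v /bd[].
    case: pq; rewrite [p]surjective_pairing [q]surjective_pairing.
    by congr pair; apply/esym/eqP; rewrite -subr_eq0 ?e1 ?e2.
  by apply: (bnd _ _ n1) => v /bd[].
have hl : has_lbound L by exists (- B) => v /LB; rewrite ler_norml => /andP[].
have hu : has_ubound L by exists B => v /LB; rewrite ler_norml => /andP[].
have iLe := interval_bounded_interior iL hl hu.
have a0 : inf L <= 0 by exact: ge_inf.
have b1 : 1 <= sup L by exact: ub_le_sup.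
split.
  rewrite SL; apply: connected_continuous_connected; first exact/connected_intervalP.
  by apply: continuous_subspaceT; exact: seg_continuous.
have seg_seg t : ((seg p q (inf L)).1 + t * ((seg p q (sup L)).1 - (seg p q (inf L)).1),
    (seg p q (inf L)).2 + t * ((seg p q (sup L)).2 - (seg p q (inf L)).2)) =
    seg p q (inf L + t * (sup L - inf L)).
  by rewrite /seg /=; congr pair; ring.
exists (seg p q (inf L)), (seg p q (sup L)); split.
  move=> E; apply: pq; move: E; rewrite /seg => -[E1 E2].
  have n0 : sup L - inf L != 0 by rewrite gt_eqF //; lra.
  rewrite [p]surjective_pairing [q]surjective_pairing.
  have F1 : (sup L - inf L) * (q.1 - p.1) = 0 by lra.
  have F2 : (sup L - inf L) * (q.2 - p.2) = 0 by lra.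
  move/eqP: F1; move/eqP: F2; rewrite !mulf_eq0 (negbTE n0) /= !subr_eq0.
  by move=> /eqP -> /eqP ->.
split=> [_ [t /andP[t0 t1] <-]|r].
  rewrite seg_seg SL; exists (inf L + t * (sup L - inf L)) => //.
  apply: (@interior_subset _ L); rewrite iLe /=.
  have d0 : 0 < sup L - inf L by lra.
  have := mulr_gt0 t0 d0; have : t * (sup L - inf L) < sup L - inf L by rewrite gtr_pMl.
  by move=> *; apply/andP; split; lra.
rewrite {1}SL => -[v Lv <-].
have d0 : 0 < sup L - inf L by lra.
have vi : inf L <= v by exact: ge_inf.
have vs : v <= sup L by exact: ub_le_sup.
exists ((v - inf L) / (sup L - inf L)) => /=.
  apply/andP; split; first by apply: divr_ge0; lra.
  by rewrite ler_pdivrMr // mul1r; lra.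
by rewrite seg_seg divfK ?gt_eqF // subrKC.
Qed.

Lemma convex_cell_finite {R : realType} (X e : set (R * R)) (A : set (set (R * R)))
    (gam : R -> R * R) (M : R) :
  shortest_curve X gam -> convex2 e -> e `<=` X ->
  (forall r, e r -> `|r.1| <= M /\ `|r.2| <= M) ->
  finite_set (components (image01 gam `&` e)) /\
    forall C, components (image01 gam `&` e) C ->
      (exists p, C = [set p]) \/ geodesic_segment A C.
Proof.
move=> sh ce eX bd; set S := image01 gam `&` e.
have cS : convex2 S by exact: shortest_curve_convex sh ce eX.
have [[p [Sp all]]|H] := pselect (exists p, S p /\ forall q, S q -> q = p).
  have SE : S = [set p] by apply/seteqP; split => [q /all|q ->].
  have -> : components S = [set [set p]].
    rewrite /components SE; apply/seteqP; split => [_ [_ -> <-]|_ ->] /=.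
      by rewrite connected_component_id //; exact: connected1.
    by exists p => //; rewrite connected_component_id //; exact: connected1.
  by split; [exact: finite_set1|move=> _ ->; left; exists p].
(* S is now empty or has two distinct points. The empty case is covered because everything is
   derived from a given point of S, and the empty set has no component. *)
have K p : S p -> connected S /\ straight_segment S.
  move=> Sp; have [q [Sq qp]] : exists q, S q /\ q <> p.
    apply: contrapT => h; apply: H; exists p; split => // q Sq.
    by apply: contrapT => qp; apply: h; exists q.
  apply: (@convex_in_line _ S p q M) => //; first by move=> pq; apply: qp.
    by move=> r Sr; apply: (shortest_curve_collinear sh ce eX Sp Sq Sr) => pq; apply: qp.
  by move=> r [_ /bd].
have cE C : components S C -> C = S /\ straight_segment S.
  move=> [p Sp <-]; have [co st] := K p Sp; split => //.
  exact: connected_component_id.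
split; last by move=> C /cE[-> st]; right; left.
by apply: (@sub_finite_set _ _ [set S]); [move=> C /cE[->]|exact: finite_set1].
Qed.

(** * Boxes and their characteristic maps *)

(** The open interval for a < b and the point for a = b, so that vertices, edges and squares are
    boxes of one form. *)
Definition relint {R : realType} (a b : R) : set R :=
  [set w | a <= w <= b /\ (a < b -> a < w < b)].

Definition rbox {R : realType} (a b c d : R) : set (R * R) :=
  [set z | relint a b z.1 /\ relint c d z.2].

Definition cbox {R : realType} (a b c d : R) : set (R * R) :=
  [set z | a <= z.1 <= b /\ c <= z.2 <= d].

Lemma relintE_eq {R : realType} (a : R) : relint a a = [set a].
Proof.
apply/seteqP; split => [w /= [aw _]|w /= ->]; last by rewrite /relint /= lexx ltxx.
by apply/eqP; rewrite eq_le andbC.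
Qed.

Lemma relintE_lt {R : realType} (a b : R) : a < b -> relint a b = [set w | a < w < b].
Proof.
move=> ab; apply/seteqP; split => [w /= [_]|w /= /andP[aw wb]]; first exact.
by split; rewrite ?aw // !ltW.
Qed.

Lemma semialg_relint {R : realType} (f : R * R -> R) (a b : R) :
  (forall c, semialg [set z | c < f z] /\ semialg [set z | f z < c]) ->
  a <= b -> semialg [set z | relint a b (f z)].
Proof.
move=> E; rewrite le_eqVlt => /predU1P[<-|ab].
  have := sa_inter (sa_compl (E a).1) (sa_compl (E a).2); congr semialg.
  rewrite relintE_eq; apply/seteqP; split => z /=.
    by move=> [/negP + /negP]; rewrite -!leNgt => ? ?; apply/eqP; rewrite eq_le; apply/andP.
  by move=> ->; rewrite ltxx.
have := sa_inter (E a).1 (E b).2; congr semialg.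
by rewrite relintE_lt //; apply/seteqP; split => z /=; [move=> [-> ->]|move=> /andP[]].
Qed.

Lemma semialg_halfplanes {R : realType} (f : R * R -> R) (p : {poly {poly R}}) :
  peval2 p = f -> forall c, semialg [set z | c < f z] /\ semialg [set z | f z < c].
Proof.
move=> <- c; split.
  have := sa_pos (p - c%:P%:P); congr semialg.
  by apply/seteqP; split => z /=; rewrite /peval2 !hornerE subr_gt0.
have := sa_pos (c%:P%:P - p); congr semialg.
by apply/seteqP; split => z /=; rewrite /peval2 !hornerE subr_gt0.
Qed.

Lemma semialg_rbox {R : realType} (a b c d : R) : a <= b -> c <= d ->
  semialg (rbox a b c d).
Proof.
move=> ab cd; apply: (sa_inter (S := [set z | relint a b z.1]) (T := [set z | relint c d z.2])).
  apply: semialg_relint ab; apply: (semialg_halfplanes (p := 'X%:P)).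
  by apply/funext => z; rewrite /peval2 !hornerE.
apply: semialg_relint cd; apply: (semialg_halfplanes (p := 'X)).
by apply/funext => z; rewrite /peval2 !hornerE.
Qed.

Lemma relint_convex {R : realType} (a b x y u : R) :
  relint a b x -> relint a b y -> 0 <= u <= 1 -> relint a b (x + u * (y - x)).
Proof.
move=> [/andP[ax xb] sx] [/andP[ay yb] sy] /andP[u0 u1]; split.
  by apply/andP; split; nra.
move=> ab; have /andP[{}ax {}xb] := sx ab; have /andP[{}ay {}yb] := sy ab.
by have [xy|yx] := leP x y; apply/andP; split; nra.
Qed.

Lemma rbox_convex {R : realType} (a b c d : R) : convex2 (rbox a b c d).
Proof. by move=> p q u [p1 p2] [q1 q2] u01; split; exact: relint_convex. Qed.

Lemma rbox_sub_cbox {R : realType} (a b c d : R) : rbox a b c d `<=` cbox a b c d.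
Proof. by move=> z [[? _] [? _]]. Qed.

Lemma cbox_bounded {R : realType} (a b c d : R) : exists M, forall z : R * R,
  cbox a b c d z -> `|z.1| <= M /\ `|z.2| <= M.
Proof.
exists (`|a| + `|b| + `|c| + `|d|) => z [/andP[az zb] /andP[cz zd]].
have := ler_norm a; have := ler_norm b; have := ler_norm c; have := ler_norm d.
have := lerNnormlW (lexx `|a|); have := lerNnormlW (lexx `|b|).
have := lerNnormlW (lexx `|c|); have := lerNnormlW (lexx `|d|).
by rewrite !ler_norml => *; split; apply/andP; split; lra.
Qed.

Lemma closed_cbox {R : realType} (a b c d : R) : closed (cbox a b c d : set (R * R)).
Proof.
have -> : cbox a b c d = (fst @^-1` `[a, b]%classic) `&` (snd @^-1` `[c, d]%classic).
  by apply/seteqP; split => z /=; rewrite !in_itv.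
by apply: closedI; apply: closed_comp => [z _|]; rewrite ?itv_closed//;
  [exact: cvg_fst|exact: interval_closed|exact: cvg_snd|exact: interval_closed].
Qed.

(** * The radial homeomorphism between disk and square *)

Definition norm2 {R : realType} (u : R * R) : R := Num.sqrt (u.1 ^+ 2 + u.2 ^+ 2).
Definition normoo {R : realType} (u : R * R) : R := Num.max `|u.1| `|u.2|.

(** For norms f and g, the radial map taking each level set of f to the level set of g with the same
    value; the origin is fixed. *)
Definition rescale {R : realType} (f g : R * R -> R) (u : R * R) : R * R :=
  (f u / g u * u.1, f u / g u * u.2).

Definition homogeneous_norm {R : realType} (f : R * R -> R) : Prop :=
  [/\ continuous f, forall u, u <> (0, 0) -> 0 < f u, f (0, 0) = 0 &
      forall k u, 0 <= k -> f (k * u.1, k * u.2) = k * f u].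

Lemma norm2_homogeneous {R : realType} : homogeneous_norm (@norm2 R).
Proof.
split.
- move=> u; exact: (@continuous_sqrt_sqr2 _ _ fst snd u (@cvg_fst _ _ _ _ _) (@cvg_snd _ _ _ _ _)).
- move=> [x y] u0; rewrite /norm2 sqrtr_gt0 lt_neqAle addr_ge0 ?sqr_ge0 // andbT eq_sym.
  rewrite paddr_eq0 ?sqr_ge0 // !sqrf_eq0 /=; apply/negP => /andP[/eqP x0 /eqP y0].
  by apply: u0; rewrite x0 y0.
- by rewrite /norm2 /= expr0n /= addr0 sqrtr0.
- move=> k u k0; rewrite /norm2 /= !exprMn -mulrDr sqrtrM ?sqr_ge0 //.
  by rewrite sqrtr_sqr ger0_norm.
Qed.

Lemma normoo_homogeneous {R : realType} : homogeneous_norm (@normoo R).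
Proof.
split.
- move=> u; apply: (@continuous_max _ _ (fun u : R * R => `|u.1|) (fun u : R * R => `|u.2|)).
    by apply: (@continuous_comp _ _ _ fst (fun x : R => `|x|)); [exact: cvg_fst|exact: norm_continuous].
  by apply: (@continuous_comp _ _ _ snd (fun x : R => `|x|)); [exact: cvg_snd|exact: norm_continuous].
- move=> [x y] u0; rewrite /normoo lt_max !normr_gt0 /=.
  have [x0|//] := eqVneq x 0; have [y0|//] := eqVneq y 0.
  by case: u0; rewrite x0 y0.
- by rewrite /normoo /= normr0 maxxx.
- by move=> k u k0; rewrite /normoo /= !normrM (ger0_norm k0) maxr_pMr.
Qed.

Lemma normoo_le_norm2 {R : realType} (u : R * R) : normoo u <= norm2 u.
Proof.
rewrite /normoo ge_max /norm2 -!sqrtr_sqr !ler_sqrt ?addr_ge0 ?sqr_ge0 //.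
by rewrite lerDl lerDr !sqr_ge0.
Qed.

Lemma norm2_le_normoo {R : realType} (u : R * R) : norm2 u <= 2 * normoo u.
Proof.
have m1 : `|u.1| <= normoo u by rewrite /normoo le_max lexx.
have m2 : `|u.2| <= normoo u by rewrite /normoo le_max lexx orbT.
have m0 : 0 <= normoo u by exact: le_trans m1.
rewrite -(ger0_norm (mulr_ge0 (ler0n R 2) m0)) -sqrtr_sqr /norm2 ler_sqrt ?sqr_ge0 //.
rewrite -(real_normK (num_real u.1)) -(real_normK (num_real u.2)).
have := normr_ge0 u.1; have := normr_ge0 u.2; nra.
Qed.

Lemma homogeneous_norm_ge0 {R : realType} (f : R * R -> R) u : homogeneous_norm f -> 0 <= f u.
Proof.
move=> [_ fp f0 _]; have [->|/fp/ltW //] := pselect (u = (0, 0)); by rewrite f0.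
Qed.

Lemma rescale0 {R : realType} (f g : R * R -> R) : rescale f g (0, 0) = (0, 0).
Proof. by rewrite /rescale /= !mulr0. Qed.

Lemma rescale_norm {R : realType} (f g : R * R -> R) u :
  homogeneous_norm f -> homogeneous_norm g -> g (rescale f g u) = f u.
Proof.
move=> hf hg; have f0 := homogeneous_norm_ge0 u hf; have g0 := homogeneous_norm_ge0 u hg.
have [->|un] := pselect (u = (0, 0)).
  by rewrite rescale0; have [_ _ -> _] := hf; have [_ _ -> _] := hg.
have [_ gp _ ->] := hg; last exact: divr_ge0.
by rewrite divfK // lt0r_neq0 // gp.
Qed.

Lemma rescaleK {R : realType} (f g : R * R -> R) u :
  homogeneous_norm f -> homogeneous_norm g -> rescale g f (rescale f g u) = u.
Proof.
move=> hf hg; have f0 := homogeneous_norm_ge0 u hf; have g0 := homogeneous_norm_ge0 u hg.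
have [->|un] := pselect (u = (0, 0)); first by rewrite !rescale0.
have gu : g u != 0 by have [_ gp _ _] := hg; rewrite lt0r_neq0 // gp.
have fu : f u != 0 by have [_ fp _ _] := hf; rewrite lt0r_neq0 // fp.
rewrite {1}/rescale rescale_norm //.
have -> : f (rescale f g u) = f u / g u * f u.
  by have [_ _ _ ->] := hf => //; exact: divr_ge0.
rewrite /rescale /= [RHS]surjective_pairing; congr pair; field; by rewrite gu fu.
Qed.

(** Away from the origin the factor f / g is continuous. At the origin it may have no limit, but it
    is at most 2, so its products with the coordinates tend to 0. The crude bound 2 serves the
    Euclidean and the maximum norm in both orders. *)
Lemma rescale_continuous {R : realType} (f g : R * R -> R) :
  homogeneous_norm f -> homogeneous_norm g -> (forall u, f u <= 2 * g u) ->
  continuous (rescale f g).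
Proof.
move=> hf hg fg u; have [cf fp f0 _] := hf; have [cg gp g0 _] := hg.
have [->|un] := pselect (u = (0, 0)).
  have bound (h : R * R -> R) : (forall v, `|h v| <= `|v|) ->
      {for (0, 0), continuous (fun v => f v / g v * h v)}.
    move=> hv; rewrite /prop_for /continuous_at f0 mul0r mul0r; apply/cvgrPdist_le => e e0.
    have e2 : 0 < e / 2 by rewrite divr_gt0.
    have := nbhsx_ballx ((0, 0) : R * R) (e / 2) e2.
    apply: filterS => v; rewrite -ball_normE /ball_ /= sub0r normrN => ve.
    rewrite sub0r normrN normrM ger0_norm; last first.
      by apply: divr_ge0; exact: homogeneous_norm_ge0.
    have fgv : f v / g v <= 2.
      have [->|/gp gv] := pselect (v = (0, 0)); first by rewrite f0 mul0r.
      by rewrite ler_pdivrMr.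
    apply: (@le_trans _ _ (2 * (e / 2))); last by rewrite mulrC divfK.
    apply: ler_pM => //; last by apply: le_trans (ltW ve).
    by apply: divr_ge0; exact: homogeneous_norm_ge0.
  have b1 : {for (0, 0), continuous (fun v => f v / g v * v.1)}.
    by apply: (bound fst) => v; rewrite prod_normE /= le_max lexx.
  have b2 : {for (0, 0), continuous (fun v => f v / g v * v.2)}.
    by apply: (bound snd) => v; rewrite prod_normE /= le_max lexx orbT.
  exact: (continuous_pair b1 b2).
have c : {for u, continuous (fun v => f v / g v)}.
  apply: (@continuousM _ _ f (fun v => (g v)^-1)); first exact: cf.
  by apply: (@continuousV _ _ g); [rewrite lt0r_neq0 // gp|exact: cg].
have c1 : {for u, continuous (fun v => f v / g v * v.1)}.
  by apply: (@continuousM _ _ (fun v => f v / g v) fst); [exact: c|exact: cvg_fst].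
have c2 : {for u, continuous (fun v => f v / g v * v.2)}.
  by apply: (@continuousM _ _ (fun v => f v / g v) snd); [exact: c|exact: cvg_snd].
exact: (continuous_pair c1 c2).
Qed.

(** The geometric half of the cell condition in [CW_complex]: the boundary sphere goes to the box
    minus the cell. Which lower cells cover that frontier is a separate, combinatorial question. *)
Definition characteristic_map {R : realType} (n : nat) (e box : set (R * R)) : Prop :=
  exists Phi : R * R -> R * R,
    {within ball_closed n, continuous Phi} /\
    Phi @` ball_closed n `<=` box /\
    Phi @` ball_interior n = e /\
    (exists Psi : R * R -> R * R,
       (forall u, ball_interior n u -> Psi (Phi u) = u) /\
       {within e, continuous Psi}) /\
    Phi @` ball_boundary n `<=` box `\` e.

(** The affine map of [-1, 1] onto [a, b]; it and its inverse [unmid] are spelt as [c + k * x] so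
    that the continuity of affine maps applies by conversion. *)
Definition mid {R : realType} (a b x : R) : R := (a + b) / 2 + (b - a) / 2 * x.
Definition unmid {R : realType} (a b w : R) : R := - (a + b) / (b - a) + 2 / (b - a) * w.

Lemma midK {R : realType} (a b x : R) : a < b -> unmid a b (mid a b x) = x.
Proof.
by rewrite -subr_gt0 => ab; rewrite /unmid /mid; field; rewrite lt0r_neq0.
Qed.

Lemma unmidK {R : realType} (a b x : R) : a < b -> mid a b (unmid a b x) = x.
Proof.
by rewrite -subr_gt0 => ab; rewrite /unmid /mid; field; rewrite lt0r_neq0.
Qed.

Lemma mid_le {R : realType} (a b x : R) : a < b -> (a <= mid a b x <= b) = (`|x| <= 1).
Proof.
by move=> ab; rewrite ler_norml /mid; apply/andP/andP => -[? ?]; split; nra.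
Qed.

Lemma mid_lt {R : realType} (a b x : R) : a < b -> (a < mid a b x < b) = (`|x| < 1).
Proof.
by move=> ab; rewrite ltr_norml /mid; apply/andP/andP => -[? ?]; split; nra.
Qed.

Lemma continuous_paired {T U V : topologicalType} (f : T -> U) (g : T -> V) :
  continuous f -> continuous g -> continuous (fun t => (f t, g t)).
Proof. by move=> cf cg t; exact: continuous_pair (cf t) (cg t). Qed.

Lemma continuous_affine1 {R : realType} (k c : R) :
  continuous (fun z : R * R => c + k * z.1).
Proof.
move=> z; apply: (@continuous_comp _ _ _ fst (fun x => c + k * x)); first exact: cvg_fst.
exact: (C2_continuous (C2_affine k c)).
Qed.

Lemma continuous_affine2 {R : realType} (k c : R) :
  continuous (fun z : R * R => c + k * z.2).
Proof.
move=> z; apply: (@continuous_comp _ _ _ snd (fun x => c + k * x)); first exact: cvg_snd.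
exact: (C2_continuous (C2_affine k c)).
Qed.

Lemma normoo_lt1 {R : realType} (u : R * R) : (normoo u < 1) = (`|u.1| < 1) && (`|u.2| < 1).
Proof. by rewrite /normoo gt_max. Qed.

Lemma normoo_le1 {R : realType} (u : R * R) : (normoo u <= 1) = (`|u.1| <= 1) && (`|u.2| <= 1).
Proof. by rewrite /normoo ge_max. Qed.

Lemma norm2_lt1 {R : realType} (u : R * R) : (norm2 u < 1) = (u.1 ^+ 2 + u.2 ^+ 2 < 1).
Proof. by rewrite /norm2 -[X in _ < X]sqrtr1 ltr_sqrt. Qed.

Lemma norm2_le1 {R : realType} (u : R * R) : (norm2 u <= 1) = (u.1 ^+ 2 + u.2 ^+ 2 <= 1).
Proof. by rewrite /norm2 -[X in _ <= X]sqrtr1 ler_sqrt. Qed.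

Definition disk_to_box {R : realType} (a b c d : R) (u : R * R) : R * R :=
  (mid a b (rescale norm2 normoo u).1, mid c d (rescale norm2 normoo u).2).

Definition box_to_disk {R : realType} (a b c d : R) (z : R * R) : R * R :=
  rescale normoo norm2 (unmid a b z.1, unmid c d z.2).

Lemma disk_to_box_continuous {R : realType} (a b c d : R) : continuous (disk_to_box a b c d).
Proof.
have cr := rescale_continuous (@norm2_homogeneous R) normoo_homogeneous norm2_le_normoo.
move=> u.
have c1 : {for u, continuous (fun u => mid a b (rescale norm2 normoo u).1)}.
  have m : continuous (fun z : R * R => mid a b z.1) by exact: continuous_affine1.
  exact: (@continuous_comp _ _ _ (rescale norm2 normoo) _ u (cr u) (m _)).
have c2 : {for u, continuous (fun u => mid c d (rescale norm2 normoo u).2)}.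
  have m : continuous (fun z : R * R => mid c d z.2) by exact: continuous_affine2.
  exact: (@continuous_comp _ _ _ (rescale norm2 normoo) _ u (cr u) (m _)).
exact: (continuous_pair c1 c2).
Qed.

Lemma box_to_disk_continuous {R : realType} (a b c d : R) : continuous (box_to_disk a b c d).
Proof.
have le u : normoo u <= 2 * norm2 u :> R.
  by apply: (le_trans (normoo_le_norm2 u)); rewrite ler_peMl ?sqrtr_ge0 ?ler1n.
have cr := rescale_continuous (@normoo_homogeneous R) norm2_homogeneous le.
move=> u; apply: (@continuous_comp _ _ _ (fun z => (unmid a b z.1, unmid c d z.2)) _ u _ (cr _)).
have c1 : {for u, continuous (fun z : R * R => unmid a b z.1)} by exact: continuous_affine1.
have c2 : {for u, continuous (fun z : R * R => unmid c d z.2)} by exact: continuous_affine2.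
exact: (continuous_pair c1 c2).
Qed.

Lemma disk_to_boxK {R : realType} (a b c d : R) (ab : a < b) (cd : c < d) u :
  box_to_disk a b c d (disk_to_box a b c d u) = u.
Proof.
rewrite /box_to_disk /disk_to_box.
rewrite [X in rescale _ _ X](_ : _ = rescale norm2 normoo u).
  exact: rescaleK norm2_homogeneous normoo_homogeneous.
by rewrite [RHS]surjective_pairing; congr pair; exact: midK.
Qed.

Lemma box_to_diskK {R : realType} (a b c d : R) (ab : a < b) (cd : c < d) z :
  disk_to_box a b c d (box_to_disk a b c d z) = z.
Proof.
rewrite /box_to_disk /disk_to_box (rescaleK _ normoo_homogeneous norm2_homogeneous).
by rewrite /= !unmidK // -surjective_pairing.
Qed.

Lemma disk_to_box_closed {R : realType} (a b c d : R) (ab : a < b) (cd : c < d) u :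
  cbox a b c d (disk_to_box a b c d u) <-> u.1 ^+ 2 + u.2 ^+ 2 <= 1.
Proof.
rewrite -norm2_le1 -(rescale_norm u norm2_homogeneous normoo_homogeneous) normoo_le1.
by rewrite /cbox /disk_to_box /= !mid_le //; split; [move=> [-> ->]|move=> /andP].
Qed.

Lemma disk_to_box_open {R : realType} (a b c d : R) (ab : a < b) (cd : c < d) u :
  rbox a b c d (disk_to_box a b c d u) <-> u.1 ^+ 2 + u.2 ^+ 2 < 1.
Proof.
rewrite -norm2_lt1 -(rescale_norm u norm2_homogeneous normoo_homogeneous) normoo_lt1.
rewrite /rbox !relintE_lt // /disk_to_box /= !mid_lt //.
by split; [move=> [-> ->]|move=> /andP].
Qed.

Lemma rbox_disk {R : realType} (a b c d : R) (ab : a < b) (cd : c < d) :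
  homeomorphic (rbox a b c d) (@open_unit_disk R).
Proof.
exists (box_to_disk a b c d), (disk_to_box a b c d); split; [|split; [|split]].
- move=> z; rewrite (box_to_diskK ab cd) => hz; split => //.
  by apply/(disk_to_box_open ab cd); rewrite (box_to_diskK ab cd).
- by move=> u hu; split; [exact/(disk_to_box_open ab cd)|exact: (disk_to_boxK ab cd)].
- exact/continuous_subspaceT/box_to_disk_continuous.
- exact/continuous_subspaceT/disk_to_box_continuous.
Qed.

Lemma rbox_characteristic_map2 {R : realType} (a b c d : R) (ab : a < b) (cd : c < d) :
  characteristic_map 2 (rbox a b c d) (cbox a b c d).
Proof.
exists (disk_to_box a b c d); split; [|split; [|split; [|split]]].
- exact/continuous_subspaceT/disk_to_box_continuous.
- by move=> _ [u hu <-]; exact/(disk_to_box_closed ab cd).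
- apply/seteqP; split => [_ [u hu <-]|z hz]; first exact/(disk_to_box_open ab cd).
  exists (box_to_disk a b c d z); last exact: (box_to_diskK ab cd).
  by apply/(disk_to_box_open ab cd); rewrite (box_to_diskK ab cd).
- exists (box_to_disk a b c d); split; first by move=> u _; exact: (disk_to_boxK ab cd).
  exact/continuous_subspaceT/box_to_disk_continuous.
- move=> _ [u [hc ho] <-]; split; first exact/(disk_to_box_closed ab cd).
  by move/(disk_to_box_open ab cd).
Qed.

Lemma rbox_point {R : realType} (a c : R) : rbox a a c c = [set (a, c)].
Proof.
rewrite /rbox !relintE_eq; apply/seteqP; split => [[x y] /= [-> ->]|_ ->] //.
Qed.

Lemma rbox_characteristic_map0 {R : realType} (a c : R) :
  characteristic_map 0 (rbox a a c c) (cbox a a c c).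
Proof.
rewrite rbox_point; exists (fun=> (a, c)); split; [|split; [|split; [|split]]].
- by apply: continuous_subspaceT; exact: cst_continuous.
- by move=> _ [u _ <-]; rewrite /cbox /= !lexx.
- by apply/seteqP; split => [_ [u _ <-]|_ ->] //; exists (0, 0).
- exists (fun=> (0, 0)); split; first by move=> u ->.
  by apply: continuous_subspaceT; exact: cst_continuous.
- by move=> _ [u [hc ho] <-].
Qed.

Lemma rbox_characteristic_map1h {R : realType} (a b c : R) : a < b ->
  characteristic_map 1 (rbox a b c c) (cbox a b c c).
Proof.
move=> ab; have E x y : rbox a b c c (mid a b x, y) <-> -1 < x < 1 /\ y = c.
  by rewrite /rbox relintE_eq relintE_lt // /= mid_lt // ltr_norml.
exists (fun u => (mid a b u.1, c)); split; [|split; [|split; [|split]]].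
- apply/continuous_subspaceT/continuous_paired; last exact: cst_continuous.
  exact: continuous_affine1.
- by move=> _ [u [hu _] <-]; rewrite /cbox /= mid_le // ler_norml hu lexx.
- apply/seteqP; split => [_ [u [hu _] <-]|[x y]]; first by apply/E.
  rewrite -{1}(unmidK x ab) => /E [hx ->].
  by exists (unmid a b x, 0); rewrite /= ?unmidK.
- exists (fun z => (unmid a b z.1, 0)); split.
    by move=> [x y] [_ /= ->]; rewrite midK.
  apply/continuous_subspaceT/continuous_paired; last exact: cst_continuous.
  exact: continuous_affine1.
- move=> _ [u [[hu u2] ho] <-]; split; first by rewrite /cbox /= mid_le // ler_norml hu lexx.
  by move=> /E [hx _]; apply: ho.
Qed.

Lemma rbox_characteristic_map1v {R : realType} (a c d : R) : c < d ->
  characteristic_map 1 (rbox a a c d) (cbox a a c d).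
Proof.
move=> cd; have E x y : rbox a a c d (x, mid c d y) <-> -1 < y < 1 /\ x = a.
  by rewrite /rbox relintE_eq relintE_lt // /= mid_lt // ltr_norml; split => -[].
exists (fun u => (a, mid c d u.1)); split; [|split; [|split; [|split]]].
- apply/continuous_subspaceT/continuous_paired; first exact: cst_continuous.
  exact: continuous_affine1.
- by move=> _ [u [hu _] <-]; rewrite /cbox /= mid_le // ler_norml hu lexx.
- apply/seteqP; split => [_ [u [hu _] <-]|[x y]]; first by apply/E.
  rewrite -{1}(unmidK y cd) => /E [hy ->].
  by exists (unmid c d y, 0); rewrite /= ?unmidK.
- exists (fun z => (unmid c d z.2, 0)); split.
    by move=> [x y] [_ /= ->]; rewrite midK.
  apply/continuous_subspaceT/continuous_paired; last exact: cst_continuous.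
  exact: continuous_affine2.
- move=> _ [u [[hu u2] ho] <-]; split; first by rewrite /cbox /= mid_le // ler_norml hu lexx.
  by move=> /E [hx _]; apply: ho.
Qed.

Lemma rbox_characteristic_map {R : realType} (a b c d : R) : a <= b -> c <= d ->
  characteristic_map ((a < b)%R + (c < d)%R) (rbox a b c d) (cbox a b c d).
Proof.
rewrite le_eqVlt => /predU1P[<-|ab]; rewrite le_eqVlt => /predU1P[<-|cd].
- by rewrite !ltxx; exact: rbox_characteristic_map0.
- by rewrite ltxx cd; exact: rbox_characteristic_map1v.
- by rewrite ltxx ab; exact: rbox_characteristic_map1h.
- by rewrite ab cd; exact: rbox_characteristic_map2.
Qed.

(** Meant for open edges, with f a coordinate and g the inclusion of the line that carries the
    edge. *)
Lemma itv_homeomorphic {R : realType} (e : set (R * R)) (a b : R)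
    (f : R * R -> R) (g : R -> R * R) : a < b -> continuous f -> continuous g ->
  (forall t, e (g t) <-> a < t < b) -> (forall t, f (g t) = t) ->
  (forall z, e z -> g (f z) = z) ->
  homeomorphic e (@open_unit_interval R).
Proof.
move=> ab cf cg eg fg gf; have ba : 0 < b - a by rewrite subr_gt0.
have n0 : b - a != 0 by rewrite lt0r_neq0.
exists (fun z => - a / (b - a) + (b - a)^-1 * f z), (fun t => g (a + (b - a) * t)).
have H w : 0 < - a / (b - a) + (b - a)^-1 * w < 1 = (a < w < b).
  have -> : - a / (b - a) + (b - a)^-1 * w = (w - a) / (b - a) by field.
  by rewrite ltr_pdivlMr // mul0r subr_gt0 ltr_pdivrMr // mul1r ltrD2r.
split; [|split; [|split]].
- move=> z ez; split; first by rewrite /open_unit_interval /= H; apply/eg; rewrite gf.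
  by rewrite -[RHS]gf //; congr g; field.
- move=> t ht; split; last by rewrite fg; field.
  apply/eg; rewrite -H; have -> // : - a / (b - a) + (b - a)^-1 * (a + (b - a) * t) = t by field.
- apply: continuous_subspaceT => z.
  apply: (@continuous_comp _ _ _ f (fun t => - a / (b - a) + (b - a)^-1 * t)); first exact: cf.
  exact: (C2_continuous (C2_affine _ _)).
- apply: continuous_subspaceT => z.
  apply: (@continuous_comp _ _ _ (fun t => a + (b - a) * t) g); last exact: cg.
  exact: (C2_continuous (C2_affine _ _)).
Qed.

Lemma rbox_is_cell {R : realType} (a b c d : R) : a <= b -> c <= d ->
  is_cell (rbox a b c d).
Proof.
move=> ab cd; split; first exact: semialg_rbox.
move: ab cd; rewrite le_eqVlt => /predU1P[<-|ab]; rewrite le_eqVlt => /predU1P[<-|cd].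
- by constructor 1; exists (a, c); exact: rbox_point.
- constructor 2; apply: (@itv_homeomorphic _ _ c d snd (fun t => (a, t))) => //.
  + by move=> z; exact: cvg_snd.
  + by apply: continuous_paired; [exact: cst_continuous|move=> t; exact: cvg_id].
  + by move=> t; rewrite /rbox relintE_eq relintE_lt //=; split => [[]|].
  + by move=> [x y]; rewrite /rbox relintE_eq /= => -[-> _].
- constructor 2; apply: (@itv_homeomorphic _ _ a b fst (fun t => (t, c))) => //.
  + by move=> z; exact: cvg_fst.
  + by apply: continuous_paired; [move=> t; exact: cvg_id|exact: cst_continuous].
  + by move=> t; rewrite /rbox relintE_eq relintE_lt //=; split => [[]|].
  + by move=> [x y]; rewrite /rbox relintE_eq /= => -[_ ->].
- by constructor 3; exact: rbox_disk.
Qed.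

(** * The dyadic decomposition of an open set *)

Definition dfloor {R : realType} (n : nat) (x : R) : int := Num.floor (2 ^+ n * x).
Definition dceil {R : realType} (n : nat) (x : R) : int := Num.ceil (2 ^+ n * x).
Definition lo {R : realType} (n : nat) (x : R) : R := (dfloor n x)%:~R / 2 ^+ n.
Definition hi {R : realType} (n : nat) (x : R) : R := (dceil n x)%:~R / 2 ^+ n.

(** The ceiling separates a grid point from the open interval to its right, where the floor is the
    same. *)
Definition same_cell {R : realType} (n : nat) (w x : R) : Prop :=
  dfloor n w = dfloor n x /\ dceil n w = dceil n x.

(** The closed level-n cell of x contains w; in integer form this is a preorder whose symmetric part
    is [same_cell]. *)
Definition face {R : realType} (n : nat) (w x : R) : Prop :=
  dfloor n x <= dfloor n w /\ dceil n w <= dceil n x.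

Lemma pow2_gt0 {R : realType} (n : nat) : 0 < 2 ^+ n :> R.
Proof. exact: exprn_gt0. Qed.

Lemma dfloor_le {R : realType} (n : nat) (x : R) : (dfloor n x)%:~R <= 2 ^+ n * x.
Proof. exact: floor_le. Qed.

Lemma dfloor_gt {R : realType} (n : nat) (x : R) : 2 ^+ n * x < (dfloor n x)%:~R + 1.
Proof. by have := floorD1_gt (2 ^+ n * x); rewrite intrD. Qed.

Lemma dceil_ge {R : realType} (n : nat) (x : R) : 2 ^+ n * x <= (dceil n x)%:~R.
Proof. exact: ceil_ge. Qed.

Lemma dceil_lt {R : realType} (n : nat) (x : R) : (dceil n x)%:~R - 1 < 2 ^+ n * x.
Proof. by have := ceilB1_lt (2 ^+ n * x); rewrite intrB. Qed.

Lemma dfloor_dceil {R : realType} (n : nat) (x : R) :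
  dceil n x = dfloor n x \/ dceil n x = dfloor n x + 1.
Proof.
by rewrite /dceil ceil_floor; case: (_ \is a _); [left; rewrite addr0|right].
Qed.

Lemma dceil_le_dfloor1 {R : realType} (n : nat) (x : R) :
  (dceil n x)%:~R <= (dfloor n x)%:~R + 1 :> R.
Proof. by have [->|->] := dfloor_dceil n x; rewrite ?intrD ?lexx ?lerDl. Qed.

Lemma lo_hi {R : realType} (n : nat) (x : R) : lo n x <= hi n x.
Proof.
rewrite /lo /hi ler_pM2r ?invr_gt0 ?pow2_gt0 //.
exact: le_trans (dfloor_le n x) (dceil_ge n x).
Qed.

Lemma lo_lt_hi {R : realType} (n : nat) (x : R) : (lo n x < hi n x) = (dfloor n x < dceil n x).
Proof. by rewrite /lo /hi ltr_pM2r ?invr_gt0 ?pow2_gt0 // ltr_int. Qed.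

Lemma lo_leE {R : realType} (n : nat) (x w : R) :
  (lo n x <= w) = ((dfloor n x)%:~R <= 2 ^+ n * w).
Proof. by rewrite /lo ler_pdivrMr ?pow2_gt0 // mulrC. Qed.

Lemma hi_geE {R : realType} (n : nat) (x w : R) :
  (w <= hi n x) = (2 ^+ n * w <= (dceil n x)%:~R).
Proof. by rewrite /hi ler_pdivlMr ?pow2_gt0 // mulrC. Qed.

Lemma lo_ltE {R : realType} (n : nat) (x w : R) :
  (lo n x < w) = ((dfloor n x)%:~R < 2 ^+ n * w).
Proof. by rewrite /lo ltr_pdivrMr ?pow2_gt0 // mulrC. Qed.

Lemma hi_gtE {R : realType} (n : nat) (x w : R) :
  (w < hi n x) = (2 ^+ n * w < (dceil n x)%:~R).
Proof. by rewrite /hi ltr_pdivlMr ?pow2_gt0 // mulrC. Qed.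

Lemma faceE {R : realType} (n : nat) (w x : R) : lo n x <= w <= hi n x <-> face n w x.
Proof.
rewrite lo_leE hi_geE /face /dfloor /dceil floor_ge_int ceil_le_int.
by split => [/andP[]|[-> ->]].
Qed.

Lemma same_cell_face {R : realType} (n : nat) (w x : R) :
  same_cell n w x <-> face n w x /\ face n x w.
Proof.
rewrite /same_cell /face; split => [[-> ->]|[[a b] [c d]]]; first by rewrite !lexx.
by split; apply/eqP; rewrite eq_le; apply/andP.
Qed.

Lemma same_cell_relint {R : realType} (n : nat) (w x : R) :
  same_cell n w x <-> relint (lo n x) (hi n x) w.
Proof.
rewrite /relint /= faceE lo_lt_hi lo_ltE hi_gtE; split.
  move=> [f c]; split; first by rewrite /face f c !lexx.
  rewrite -f -c => fc; have := dfloor_le n w; have := dceil_ge n w.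
  (* Equality at either end would make w a grid point, with equal floor and ceiling, against
     [fc]. *)
  rewrite !le_eqVlt => /predU1P[E|->] /predU1P[F|->] //; move: fc.
  - by rewrite -(ltr_int R) F E ltxx.
  - by rewrite /dfloor E intrKfloor ltxx.
  - by rewrite /dceil -F intrKceil ltxx.
move=> [[f c] h]; have := dfloor_dceil n x => -[E|E].
  have W : 2 ^+ n * w = (dfloor n x)%:~R.
    apply/eqP; rewrite eq_le; apply/andP; split.
      by apply: (le_trans (dceil_ge n w)); rewrite ler_int -E.
    by apply: (le_trans _ (dfloor_le n w)); rewrite ler_int.
  by rewrite /same_cell {1}/dfloor {1}/dceil W intrKfloor intrKceil E.
have /h /andP[h1 h2] : dfloor n x < dceil n x by rewrite E ltrDl.
split; first by apply: floor_def; rewrite -E h2 (ltW h1).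
by apply: ceil_def; rewrite {1}E addrK h1 (ltW h2).
Qed.

(** The grids are nested: doubling turns the level-n bounds of x into integers, which the floor and
    ceiling of level n+1 cannot cross. *)
Lemma faceS {R : realType} (n : nat) (w x : R) : face n.+1 w x -> face n w x.
Proof.
rewrite /face => -[f c].
have D (y : R) : 2 ^+ n.+1 * y = 2 * (2 ^+ n * y) by rewrite exprS mulrA.
split.
  rewrite /dfloor floor_ge_int.
  have : dfloor n x * 2 <= dfloor n.+1 w.
    apply: le_trans f; rewrite /dfloor floor_ge_int D intrM mulrC ler_pM2l //.
    exact: dfloor_le.
  rewrite /dfloor floor_ge_int D intrM mulrC ler_pM2l //.
rewrite /dceil ceil_le_int.
have : dceil n.+1 w <= dceil n x * 2.
  apply: (le_trans c); rewrite /dceil ceil_le_int D intrM mulrC ler_pM2r //.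
  exact: dceil_ge.
rewrite /dceil ceil_le_int D intrM mulrC ler_pM2r //.
Qed.

Lemma face_mono {R : realType} (k n : nat) (w x : R) : (k <= n)%N -> face n w x -> face k w x.
Proof.
move=> /subnK <-; elim: (n - k)%N => [//|j IH].
by rewrite addSn => /faceS.
Qed.

Lemma same_cell_mono {R : realType} (k n : nat) (w x : R) :
  (k <= n)%N -> same_cell n w x -> same_cell k w x.
Proof. by move=> kn; rewrite !same_cell_face => -[? ?]; split; exact: face_mono kn _. Qed.

(** In one coordinate a proper face is an endpoint of an open interval: dimension 0 against 1. *)
Lemma face_dim {R : realType} (n : nat) (w x : R) : face n w x ->
  ((dfloor n w < dceil n w)%R <= (dfloor n x < dceil n x)%R)%N /\
  (~ same_cell n w x -> ((dfloor n w < dceil n w)%R < (dfloor n x < dceil n x)%R)%N).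
Proof.
rewrite /same_cell /face => -[f c]; have := dfloor_dceil n x; have := dfloor_dceil n w.
set a := dfloor n w in f *; set b := dceil n w in c *.
set d := dfloor n x in f *; set e := dceil n x in c *.
move=> H1 H2.
have [ab|ab] := ltP a b; have [de|de] := ltP d e.
- by split => // h; case: h; split; lia.
- by exfalso; lia.
- by split.
- by split => // h; case: h; split; lia.
Qed.

(** * Grid cells in the plane and the level of a point *)

Definition gcell {R : realType} (n : nat) (z : R * R) : set (R * R) :=
  [set w | same_cell n w.1 z.1 /\ same_cell n w.2 z.2].

Lemma gcellE {R : realType} (n : nat) (z : R * R) :
  gcell n z = rbox (lo n z.1) (hi n z.1) (lo n z.2) (hi n z.2).
Proof.
by apply/seteqP; split => w; rewrite /gcell /rbox /= !same_cell_relint.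
Qed.

Lemma gcell_refl {R : realType} (n : nat) (z : R * R) : gcell n z z.
Proof. by []. Qed.

Lemma gcell_eq {R : realType} (n : nat) (z w : R * R) : gcell n z w -> gcell n w = gcell n z.
Proof.
by move=> [[a b] [c d]]; rewrite /gcell /same_cell a b c d.
Qed.

Lemma gcell_mono {R : realType} (k n : nat) (z : R * R) : (k <= n)%N -> gcell n z `<=` gcell k z.
Proof. by move=> kn w [a b]; split; exact: same_cell_mono kn _. Qed.

Definition face2 {R : realType} (n : nat) (w z : R * R) : Prop :=
  face n w.1 z.1 /\ face n w.2 z.2.

Lemma cbox_face2 {R : realType} (n : nat) (w z : R * R) :
  cbox (lo n z.1) (hi n z.1) (lo n z.2) (hi n z.2) w <-> face2 n w z.
Proof. by rewrite /cbox /face2 /= !faceE. Qed.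

Lemma face2_mono {R : realType} (k n : nat) (w z : R * R) :
  (k <= n)%N -> face2 n w z -> face2 k w z.
Proof. by move=> kn [a b]; split; exact: face_mono kn _. Qed.

Lemma gcell_face2 {R : realType} (n : nat) (w z : R * R) :
  gcell n z w -> face2 n w z /\ face2 n z w.
Proof. by rewrite /gcell /= !same_cell_face => -[[a b] [c d]]. Qed.

(* Depends only on the level-n cell of x, and grows when x moves to a face of it. *)
Definition near1 {R : realType} (n : nat) (x w : R) : Prop :=
  (dceil n x)%:~R - 2 <= 2 ^+ n * w <= (dfloor n x)%:~R + 2.

(** In mesh units, the tested box extends the closed cell on either side by 1 in a coordinate where
    the cell is an open interval and by 2 where it is a grid point. *)
Definition roomy {R : realType} (U : set (R * R)) (n : nat) (z : R * R) : Prop :=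
  forall w, near1 n z.1 w.1 -> near1 n z.2 w.2 -> U w.

Definition minimal_level {R : realType} (U : set (R * R)) (n : nat) (z : R * R) : Prop :=
  roomy U n z /\ forall k, (k < n)%N -> ~ roomy U k z.

Definition dyadic_cells {R : realType} (U : set (R * R)) : set (set (R * R)) :=
  [set e | exists n z, minimal_level U n z /\ e = gcell n z].

Lemma near1_face {R : realType} (n : nat) (w x v : R) : face n w x -> near1 n x v -> near1 n w v.
Proof.
rewrite /face /near1 -!(ler_int R) => -[f c] /andP[a b]; apply/andP; split; lra.
Qed.

(** The box tested at a face contains the box tested at the cell, so a face is the more demanding of
    the two. *)
Lemma roomy_face {R : realType} (U : set (R * R)) (n : nat) (w z : R * R) :
  face2 n w z -> roomy U n w -> roomy U n z.
Proof. by move=> [f1 f2] rw v n1 n2; apply: rw; apply: near1_face; eauto. Qed.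

Lemma face_near1 {R : realType} (n : nat) (w x : R) : face n w x -> near1 n x w.
Proof.
rewrite /face /near1 -!(ler_int R) => -[f c].
have := dfloor_le n w; have := dceil_ge n w; have := dfloor_gt n x; have := dceil_lt n x.
have := dfloor_le n x; have := dceil_ge n x.
by move=> *; apply/andP; split; lra.
Qed.

Lemma face2_sub {R : realType} (U : set (R * R)) (n : nat) (w z : R * R) :
  roomy U n z -> face2 n w z -> U w.
Proof. by move=> rz [f1 f2]; apply: rz; exact: face_near1. Qed.

(** This fixes the constant 2 of [near1]. In level-n units v exceeds w by at most c/2 for a constant
    c, and w exceeds the floor of x by at most 1; the sum stays below c exactly when c >= 2. *)
Lemma near1S {R : realType} (n : nat) (w x v : R) : face n w x -> near1 n.+1 w v -> near1 n x v.
Proof.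
rewrite /face /near1 -!(ler_int R) => -[f c] /andP[a b]; have := dceil_le_dfloor1 n x.
have := dfloor_le n w; have := dceil_ge n w; have := dfloor_gt n x; have := dceil_lt n x.
have := dfloor_le n x; have := dceil_ge n x.
have := dfloor_le n.+1 w; have := dceil_ge n.+1 w.
move: a b; rewrite exprS -!mulrA; set X := 2 ^+ n * x; set V := 2 ^+ n * v.
by set W := 2 ^+ n * w => *; apply/andP; split; lra.
Qed.

Lemma roomyS {R : realType} (U : set (R * R)) (n : nat) (w z : R * R) :
  face2 n w z -> roomy U n z -> roomy U n.+1 w.
Proof. by move=> [f1 f2] rz v n1 n2; apply: rz; apply: near1S; eauto. Qed.

Lemma pow2_unbounded {R : realType} (y : R) : exists n, y < 2 ^+ n.
Proof.
exists (Num.bound `|y|); apply: (le_lt_trans (ler_norm y)).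
apply: (lt_trans (archi_boundP (normr_ge0 y))).
by rewrite -natrX ltr_nat ltn_expl.
Qed.

Lemma roomy_exists {R : realType} (U : set (R * R)) (z : R * R) : open U -> U z ->
  exists n, roomy U n z.
Proof.
move=> oU Uz; have /nbhs_ballP [r /= r0 rU] : nbhs z U by exact: open_nbhs_nbhs.
(* A point of the tested box is within two mesh steps of z in each coordinate, so a mesh below r/2
   suffices. *)
have [n hn] := pow2_unbounded (2 / r); exists n => w n1 n2; apply: rU.
have H (x v : R) : near1 n x v -> ball x r v.
  move=> /andP[a b]; have := dceil_ge n x; have := dfloor_le n x => f c.
  move: hn; rewrite ltr_pdivrMr // => hn; have P0 := @pow2_gt0 R n.
  rewrite /ball /= ltr_norml; apply/andP; split; nra.
by split; apply: H.
Qed.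

Lemma minimal_level_exists {R : realType} (U : set (R * R)) (z : R * R) : open U -> U z ->
  exists n, minimal_level U n z.
Proof.
move=> oU Uz; have [n rn] := roomy_exists oU Uz.
have ex : exists n, `[< roomy U n z >] by exists n; apply/asboolP.
case: (ex_minnP ex) => k /asboolP rk min; exists k; split => // j jk /asboolP /min.
by rewrite leqNgt jk.
Qed.

Lemma minimal_level_unique {R : realType} (U : set (R * R)) (m n : nat) (z : R * R) :
  minimal_level U m z -> minimal_level U n z -> m = n.
Proof.
move=> [rm hm] [rn hn]; case: (ltngtP m n) => // h; first by case: (hn _ h).
by case: (hm _ h).
Qed.

Lemma minimal_level_le {R : realType} (U : set (R * R)) (m n : nat) (z : R * R) :
  minimal_level U m z -> roomy U n z -> (m <= n)%N.
Proof. by move=> [_ h] rn; rewrite leqNgt; apply/negP => /h. Qed.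

(** Points of one level-n cell are faces of each other at every level k <= n, so room passes both
    ways at all these levels. *)
Lemma minimal_level_gcell {R : realType} (U : set (R * R)) (n : nat) (w z : R * R) :
  gcell n z w -> minimal_level U n z -> minimal_level U n w.
Proof.
move=> /gcell_face2[wz zw] [rz hz]; split; first exact: roomy_face zw rz.
move=> k kn rk; apply: (hz _ kn).
exact: roomy_face (face2_mono (ltnW kn) wz) rk.
Qed.

Lemma minimal_level_boundary {R : realType} (U : set (R * R)) (m n : nat) (w z : R * R) :
  face2 n w z -> minimal_level U n z -> minimal_level U m w -> (n <= m)%N.
Proof.
move=> f [rz hz] [rw _]; rewrite leqNgt; apply/negP => mn; apply: (hz _ mn).
exact: roomy_face (face2_mono (ltnW mn) f) rw.
Qed.

(** * Countability, partition and closure finiteness *)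

Lemma dyadic_cells_bound {R : realType} (N K n : nat) (M x : R) :
  (n <= N)%N -> `|x| <= M -> 2 ^+ N * M + 1 <= K%:R ->
  - K%:Z <= dfloor n x /\ dceil n x <= K%:Z.
Proof.
move=> nN xM hK.
have M0 : 0 <= M by exact: le_trans xM.
have P : 2 ^+ n <= 2 ^+ N :> R by rewrite ler_eXn2l // ltr1n.
have P0 := @pow2_gt0 R n.
move: xM; rewrite ler_norml => /andP[x1 x2].
have b1 : - (2 ^+ N * M) <= 2 ^+ n * x by nra.
have b2 : 2 ^+ n * x <= 2 ^+ N * M by nra.
split; last by rewrite /dceil ceil_le_int; change (2 ^+ n * x <= K%:R); lra.
by rewrite /dfloor floor_ge_int intrN; change (- K%:R <= 2 ^+ n * x); lra.
Qed.

(** A cell is determined by its level and four integers, the floors and ceilings of its two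
    coordinates; bounds on the level and on a point confine them to a finite range. *)
Lemma dyadic_cells_bounded_finite {R : realType} (N : nat) (M : R) :
  finite_set [set e | exists n z, [/\ (n <= N)%N, `|z.1| <= M, `|z.2| <= M & e = gcell n z]].
Proof.
have [M0|M0] := ltP M 0.
  rewrite (_ : mkset _ = set0) //; apply/seteqP; split => // e [n [z [_ zM _ _]]].
  by have := le_lt_trans zM M0; rewrite ltNge normr_ge0.
pose K := Num.bound (2 ^+ N * M + 1).
have hK : 2 ^+ N * M + 1 <= K%:R.
  by apply/ltW/archi_boundP; rewrite addr_ge0 // mulr_ge0 // ltW // pow2_gt0.
pose I := 'I_(K + K).+1.
(* The integers from -K to K, coded by ordinals shifted by K. *)
pose s (i : I) : int := (i : nat)%:Z - K%:Z.
pose G (t : 'I_N.+1 * (I * I) * (I * I)) : set (R * R) :=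
  [set w | (dfloor t.1.1 w.1 = s t.1.2.1 /\ dceil t.1.1 w.1 = s t.1.2.2) /\
           (dfloor t.1.1 w.2 = s t.2.1 /\ dceil t.1.1 w.2 = s t.2.2)].
have sP (n : nat) (x : R) : (n <= N)%N -> `|x| <= M ->
    exists ij : I * I, dfloor n x = s ij.1 /\ dceil n x = s ij.2.
  move=> nN xM; have [b1 b2] := dyadic_cells_bound nN xM hK.
  have := dfloor_dceil n x; set a := dfloor n x in b1 *; set b := dceil n x in b2 * => ab.
  exists (inord (absz (a + K%:Z)), inord (absz (b + K%:Z))).
  by rewrite /s /= !inordK; [split; lia|lia|lia].
apply: (@sub_finite_set _ _ (G @` setT)); last exact/finite_image/finite_finset.
move=> _ [n [z [nN z1 z2 ->]]].
have [ij [e1 e2]] := sP _ _ nN z1; have [kl [e3 e4]] := sP _ _ nN z2.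
exists (inord n, ij, kl) => //; rewrite /G /gcell /same_cell /= inordK // e1 e2 e3 e4.
by [].
Qed.

Lemma dyadic_cells_countable {R : realType} (U : set (R * R)) : countable (dyadic_cells U).
Proof.
apply: (@sub_countable _ _ _ (\bigcup_N [set e | exists n z,
    [/\ (n <= N)%N, `|z.1| <= N%:R :> R, `|z.2| <= N%:R & e = gcell n z]])).
  apply: subset_card_le => e [n [z [_ ->]]].
  exists (n + Num.bound `|z.1| + Num.bound `|z.2|)%N => //.
  exists n, z; split => //; first by rewrite -addnA leq_addr.
    apply: (le_trans (ltW (archi_boundP (normr_ge0 z.1)))).
    by rewrite ler_nat addnAC leq_addl.
  apply: (le_trans (ltW (archi_boundP (normr_ge0 z.2)))).
  by rewrite ler_nat leq_addl.
apply: bigcup_countable => // N _.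
exact/finite_set_countable/dyadic_cells_bounded_finite.
Qed.

Lemma dyadic_cells_disjoint {R : realType} (U e e' : set (R * R)) :
  dyadic_cells U e -> dyadic_cells U e' -> e `&` e' !=set0 -> e = e'.
Proof.
move=> [n [z [mz ->]]] [n' [z' [mz' ->]]] [v [vz vz']].
have := minimal_level_unique (minimal_level_gcell vz mz) (minimal_level_gcell vz' mz') => E.
by rewrite -(gcell_eq vz) -(gcell_eq vz') E.
Qed.

Lemma dyadic_cells_cover {R : realType} (U : set (R * R)) : open U ->
  U = \bigcup_(e in dyadic_cells U) e.
Proof.
move=> oU; apply/seteqP; split => [z Uz|w [_ [n [z [mz ->]]] wz]].
  have [n mn] := minimal_level_exists oU Uz.
  by exists (gcell n z); [exists n, z|].
have [rw _] := minimal_level_gcell wz mz.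
by apply: (face2_sub rw); have [] := gcell_face2 (gcell_refl n w).
Qed.

Lemma gcell_is_cell {R : realType} (n : nat) (z : R * R) : is_cell (gcell n z).
Proof. by rewrite gcellE; apply: rbox_is_cell; exact: lo_hi. Qed.

Lemma closure_gcell {R : realType} (n : nat) (z : R * R) :
  closure (gcell n z) `<=` [set w | face2 n w z].
Proof.
move=> w cw; apply/cbox_face2; rewrite (closure_id (cbox _ _ _ _)).1; last exact: closed_cbox.
by apply: closure_subset cw; rewrite gcellE; exact: rbox_sub_cbox.
Qed.

Lemma face2_bounded {R : realType} (n : nat) (z : R * R) :
  exists M, forall w, face2 n w z -> `|w.1| <= M /\ `|w.2| <= M.
Proof.
have [M hM] := cbox_bounded (lo n z.1) (hi n z.1) (lo n z.2) (hi n z.2).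
by exists M => w /cbox_face2 /hM.
Qed.

Lemma dyadic_cells_closure_finite {R : realType} (U e : set (R * R)) : dyadic_cells U e ->
  finite_set [set e' | dyadic_cells U e' /\ closure_in U e `&` e' !=set0].
Proof.
move=> [n [z [mz ->]]]; have [M hM] := face2_bounded n z.
apply: sub_finite_set (dyadic_cells_bounded_finite n.+1 M).
move=> _ [[n' [z' [mz' ->]]] [v [[/closure_gcell fv Uv] vz']]].
have mv := minimal_level_gcell vz' mz'; have [v1 v2] := hM v fv.
(* The cell e' is represented by the common point v, which is bounded because it lies in the closed
   cell of z. *)
exists n', v; split => //; last by rewrite (gcell_eq vz').
by apply: (minimal_level_le mv); apply: roomyS fv _; case: mz.
Qed.

(** The open star of x: its own cell when that is an open interval, and both adjacent intervals
    together with x when x is a grid point. Here x is a face of its neighbours, the reverse of the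
    closure relation. *)
Lemma face_near {R : realType} (n : nat) (x : R) : \forall v \near x, face n x v.
Proof.
have b : x \in `](((dceil n x)%:~R - 1) / 2 ^+ n), (((dfloor n x)%:~R + 1) / 2 ^+ n)[.
  rewrite in_itv /= ltr_pdivrMr ?pow2_gt0 // ltr_pdivlMr ?pow2_gt0 // mulrC.
  by rewrite dceil_lt dfloor_gt.
have := near_in_itvoo b; apply: filterS => v; rewrite in_itv /=.
rewrite ltr_pdivrMr ?pow2_gt0 // ltr_pdivlMr ?pow2_gt0 // mulrC => /andP[v1 v2].
split.
  rewrite -ltzD1 /(dfloor n v) floor_lt_int intrD; exact: v2.
rewrite -ltzD1 -ltrBlDr /(dceil n v) ceil_gt_int intrB; exact: v1.
Qed.

Lemma near_bounded {R : realType} (x : R) : \forall v \near x, `|v| <= `|x| + 1.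
Proof.
have := nbhsx_ballx x 1 ltr01; apply: filterS => v; rewrite /ball /= => h.
have -> : v = x - (x - v) by ring.
by apply: (le_trans (ler_normB _ _)); rewrite lerD2l ltW.
Qed.

(** On the open star of z, z is a face of every point, so room at z passes to them: levels near z
    are bounded by any level n that has room at z. *)
Lemma dyadic_cells_locally_finite {R : realType} (U : set (R * R)) (z : R * R) :
  open U -> U z ->
  exists2 V, nbhs z V & finite_set [set e | dyadic_cells U e /\ e `&` V !=set0].
Proof.
move=> oU Uz; have [n rz] := roomy_exists oU Uz.
pose M := (`|z.1| + 1) + (`|z.2| + 1).
exists [set v | face2 n z v /\ `|v.1| <= M /\ `|v.2| <= M].
  exists ([set x | face n z.1 x /\ `|x| <= `|z.1| + 1],
          [set x | face n z.2 x /\ `|x| <= `|z.2| + 1]).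
    by split; apply: filterI; [exact: face_near|exact: near_bounded|exact: face_near|exact: near_bounded].
  move=> [v1 v2] [[/= f1 b1] [/= f2 b2]]; split; [exact|split].
    by apply: (le_trans b1); rewrite lerDl addr_ge0.
  by apply: (le_trans b2); rewrite lerDr addr_ge0.
apply: sub_finite_set (dyadic_cells_bounded_finite n M).
move=> _ [[m [y [my ->]]] [v [vy [zv [v1 v2]]]]].
have mv := minimal_level_gcell vy my.
exists m, v; split => //; last by rewrite (gcell_eq vy).
exact: minimal_level_le mv (roomy_face zv rz).
Qed.

(* The affine dimension, when e is a product of two intervals. *)
Definition product_dim {R : realType} (e : set (R * R)) : nat :=
  (`[< exists p q, [/\ e p, e q & p.1 != q.1] >] + `[< exists p q, [/\ e p, e q & p.2 != q.2] >])%N.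

Lemma relint_mid {R : realType} (a b : R) : a <= b -> relint a b ((a + b) / 2).
Proof. by move=> ab; split => [|lab]; apply/andP; split; lra. Qed.

Lemma relint_two {R : realType} (a b x y : R) : relint a b x -> relint a b y -> x != y -> a < b.
Proof.
move=> [/andP[ax xb] _] [/andP[ay yb] _] /eqP xy; rewrite ltNge; apply/negP => ba.
by apply: xy; lra.
Qed.

Lemma relint_third {R : realType} (a b : R) : a < b -> relint a b ((2 * a + b) / 3).
Proof. by move=> ab; split => [|_]; apply/andP; split; lra. Qed.

(** [CW_complex] wants the dimension as a function of the set alone, so nondegenerate sides are
    detected by two points differing in a coordinate; a midpoint and a point one third of the way
    serve as witnesses. *)
Lemma product_dim_rbox {R : realType} (a b c d : R) : a <= b -> c <= d ->
  product_dim (rbox a b c d) = ((a < b)%R + (c < d)%R)%N.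
Proof.
move=> ab cd; congr (nat_of_bool _ + nat_of_bool _)%N; apply/asboolP/idP.
- by move=> [p [q [[p1 _] [q1 _] pq]]]; exact: relint_two p1 q1 pq.
- move=> lab; exists ((a + b) / 2, (c + d) / 2), ((2 * a + b) / 3, (c + d) / 2).
  have h := relint_mid cd; split; [split => //; exact: relint_mid|split => //; exact: relint_third|].
  by rewrite /=; apply/eqP; lra.
- by move=> [p [q [[_ p1] [_ q1] pq]]]; exact: relint_two p1 q1 pq.
- move=> lcd; exists ((a + b) / 2, (c + d) / 2), ((a + b) / 2, (2 * c + d) / 3).
  have h := relint_mid ab; split; [split => //; exact: relint_mid|split => //; exact: relint_third|].
  by rewrite /=; apply/eqP; lra.
Qed.

Lemma product_dim_gcell {R : realType} (n : nat) (z : R * R) :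
  product_dim (gcell n z) =
  ((dfloor n z.1 < dceil n z.1)%R + (dfloor n z.2 < dceil n z.2)%R)%N.
Proof. by rewrite gcellE product_dim_rbox ?lo_hi // !lo_lt_hi. Qed.

Lemma product_dim_sub {R : realType} (e e' : set (R * R)) : e `<=` e' ->
  (product_dim e <= product_dim e')%N.
Proof.
move=> ee; have mono (P Q : Prop) : (P -> Q) -> (`[< P >] <= `[< Q >])%N.
  by move=> PQ; case: (asboolP P) => // /PQ/asboolP ->.
by apply: leq_add; apply: mono => -[p [q [ep eq pq]]]; exists p, q; split => //; exact: ee.
Qed.

(** The cell of w has a level m >= n, hence lies in the level-n grid cell of w. The latter is a
    proper face of the cell of z, so in some coordinate the dimension drops, and in the other it
    does not grow. *)
Lemma dyadic_cells_boundary {R : realType} (U : set (R * R)) (n : nat) (w z : R * R) :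
  open U -> minimal_level U n z -> face2 n w z -> ~ gcell n z w ->
  exists e', dyadic_cells U e' /\ (product_dim e' < product_dim (gcell n z))%N /\ e' w.
Proof.
move=> oU mz fw nw.
have Uw : U w by apply: face2_sub fw; case: mz.
have [m mw] := minimal_level_exists oU Uw; exists (gcell m w); split; first by exists m, w.
split => //; apply: (@leq_ltn_trans (product_dim (gcell n w))).
  exact/product_dim_sub/gcell_mono/(minimal_level_boundary fw mz mw).
rewrite !product_dim_gcell; have [f1 f2] := fw.
have [d1 s1] := face_dim f1; have [d2 s2] := face_dim f2.
have [c1|/s1 l1] := pselect (same_cell n w.1 z.1); last by rewrite -addSn leq_add.
by rewrite -addnS leq_add //; apply: s2 => c2; apply: nw.
Qed.

(** For the converse the closed set is [closure S]. Near a point z of it in U only finitely many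
    cells meet S, and a finite union of closures is closed, so z adheres to S within a single cell
    e, where the hypothesis on e applies. *)
Lemma dyadic_cells_weak_topology {R : realType} (U S : set (R * R)) : open U -> S `<=` U ->
  closed_in U S <->
  forall e, dyadic_cells U e -> closed_in (closure_in U e) (S `&` closure_in U e).
Proof.
move=> oU SU; split => [[C [cC SC]] e _|H].
  exists C; split => //; apply/seteqP; split => z.
    move=> [[Sz [ez Uz]] _]; split => //.
    by have : (S `&` U) z by []; rewrite SC => -[].
  move=> [Cz [ez Uz]]; split => //; split => //.
  by have : (C `&` U) z by []; rewrite -SC => -[].
exists (closure S); split; first exact: closed_closure.
apply/seteqP; split => z [Sz Uz]; first by split => //; exact: subset_closure.
split => //; have [V Vz fV] := dyadic_cells_locally_finite oU Uz.
set F := (X in finite_set X) in fV.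
have cD : closed (\bigcup_(e in F) closure (S `&` e)).
  by apply: closed_bigcup => // e _; exact: closed_closure.
have SVD : S `&` V `<=` \bigcup_(e in F) closure (S `&` e).
  move=> v [Sv Vv]; have := SU _ Sv; rewrite {1}(dyadic_cells_cover oU) => -[e Ae ev].
  by exists e; [split => //; exists v|apply: subset_closure].
have : closure (S `&` V) z.
  move=> B Bz; have [v [Sv [Vv Bv]]] := Sz _ (filterI Vz Bz).
  by exists v.
move=> /(closure_subset SVD); rewrite -(closure_id _).1 // => -[e [Ae _] cz].
have [C [cC SC]] := H e Ae.
have cle : closure_in U e z by split => //; apply: closure_subset cz => v [].
have Cz : C z.
  rewrite (closure_id C).1 //; apply: closure_subset cz => v [Sv ev].
  have clv : closure_in U e v by split; [exact: subset_closure|exact: SU].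
  by have : ((S `&` closure_in U e) `&` closure_in U e) v by []; rewrite SC => -[].
by have : (C `&` closure_in U e) z by []; rewrite -SC => -[[]].
Qed.

Lemma dyadic_cells_CW {R : realType} (U : set (R * R)) : open U ->
  CW_complex U (dyadic_cells U).
Proof.
move=> oU; have cov := dyadic_cells_cover oU.
split.
  move=> e Ae; split; first by rewrite {1}cov => z ez; exists e.
  by have [n [z [_ ->]]] := Ae; exists z.
split; first exact: dyadic_cells_disjoint.
split; first exact: cov.
exists product_dim; split; last first.
  by split; [exact: dyadic_cells_closure_finite|move=> S; exact: dyadic_cells_weak_topology].
move=> e [n [z [mz ->]]]; split.
  by rewrite product_dim_gcell; case: (_ < _); case: (_ < _).
have := rbox_characteristic_map (lo_hi n z.1) (lo_hi n z.2).
rewrite -product_dim_rbox ?lo_hi // -gcellE.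
move=> [Phi [cP [Pc [Pi [Ps Pb]]]]]; exists Phi; split => //; split.
  by move=> w /Pc /cbox_face2; apply: face2_sub; case: mz.
split => //; split => // w /Pb[/cbox_face2 fw nw].
by have [e' [Ae' [de' e'w]]] := dyadic_cells_boundary oU mz fw nw; exists e'.
Qed.

Lemma open_cell_decomposition {R : realType} (U : set (R * R)) : open U ->
  exists A, cell_decomposition U A /\ CW_complex U A /\ finiteness_property U A.
Proof.
move=> oU; exists (dyadic_cells U); split; [split|split].
- exact: dyadic_cells_countable.
- by move=> e [n [z [_ ->]]]; split; [exact: gcell_is_cell|exists z].
- exact: dyadic_cells_disjoint.
- exact: dyadic_cells_cover.
- exact: dyadic_cells_CW.
move=> gam sh e Ae; have [n [z [mz eE]]] := Ae.
have [M hM] := face2_bounded n z.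
apply: (@convex_cell_finite _ U e _ gam M sh).
- by rewrite eE gcellE; exact: rbox_convex.
- by rewrite {1}(dyadic_cells_cover oU) => w ew; exists e.
- by move=> w; rewrite eE => /gcell_face2[/hM].
Qed.

(** * Openness of sets given by strict polynomial inequalities *)

Lemma peval2_continuous {R : realType} (p : {poly {poly R}}) : continuous (peval2 p).
Proof.
elim/poly_ind: p => [|p c IH] z.
  have -> : peval2 (0 : {poly {poly R}}) = cst 0.
    by apply/funext => w; rewrite /peval2 !horner0.
  exact: cst_continuous.
have -> : peval2 (p * 'X + c%:P) = fun w => peval2 p w * w.2 + c.[w.1].
  by apply/funext => w; rewrite /peval2 !hornerE.
apply: (@continuousD _ _ _ (fun w => peval2 p w * w.2) (fun w => c.[w.1])).
  by apply: (@continuousM _ _ (peval2 p) snd); [exact: IH|exact: cvg_snd].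
apply: (@continuous_comp _ _ _ fst (horner c)); first exact: cvg_fst.
exact: continuous_horner.
Qed.

Lemma posset_open {R : realType} (m : nat) (g : 'I_m -> {poly {poly R}}) : open (posset g).
Proof.
rewrite openE => z gz.
apply: (@filter_forall _ _ (fun i w => is_true (0 < peval2 (g i) w)) (nbhs z)) => i.
have h : nbhs (peval2 (g i) z) [set x | 0 < x].
  by apply: open_nbhs_nbhs; split; [exact: open_gt|exact: gz].
exact: (peval2_continuous h).
Qed.

Theorem theorem3p4 (R : realType) (m : nat) (g : 'I_m -> {poly {poly R}}) :
  (0 < m)%N ->
  (forall i, g i != 0) ->
  (forall i, irreducible2 (g i)) ->
  injective g ->
  exists A : set (set (R * R)),
    cell_decomposition (posset g) A /\
    CW_complex (posset g) A /\
    finiteness_property (posset g) A.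
Proof. by move=> _ _ _ _; exact/open_cell_decomposition/posset_open. Qed.
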